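(* Let $so_\lambda$ be the character of $\mathit{SO}(2m+1)$ corresponding to the partition $\lambda$, and let $g,h\in \mathit{SO}(2m+1)$ have eigenvalues equal to $x_1,x_1^{-1},\ldots,x_m,x_m^{-1},1$ and $y_1,y_1^{-1},\ldots,y_m,y_m^{-1},1$, respectively. Then $$\sum_{\lambda} z^{|\lambda|}\, so_{\lambda}(g)\,so_{\lambda}(h) = \frac{(1-z)^m \det(C)}{z^{\binom{m}{2}}\prod_{i<j} \left(y_i+y_i^{-1}-(y_j+y_j^{-1})\right) \prod_{i<j} \left(x_i+x_i^{-1}-(x_j+x_j^{-1})\right)},$$ where $\lambda$ runs over all partitions of non-negative integers with at most $m$ parts, $0<z<1$ is an arbitrary parameter, and $C$ is the $m\times m$ matrix defined by $$C_{ij} = \frac{(1+z)^2+z(x_i+x_i^{-1}+y_j+y_j^{-1})}{(1-z x_i y_j)(1-z x_i^{-1} y_j)(1-z x_i y_j^{-1})(1-z x_i^{-1} y_j^{-1})}.$$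
   Context: Here $m\ge 1$ is an integer, and the products over $i<j$ are over $1\le i<j\le m$. $\mathit{SO}(2m+1)$ is the compact group of real orthogonal $(2m+1)\times(2m+1)$ matrices of determinant $1$. Every $g\in\mathit{SO}(2m+1)$ has an eigenvalue equal to $1$, and the remaining eigenvalues come in conjugate pairs $x_i,x_i^{-1}$. A partition with at most $m$ parts is written $\lambda=(\lambda_1\ge\cdots\ge\lambda_m\ge 0)$ with integer entries, and $|\lambda|=\sum_i\lambda_i$. The irreducible representations of $\mathit{SO}(2m+1)$ are labeled by such partitions. The character $so_\lambda$ of the one labeled by $\lambda$ is given by the Weyl character formula $$so_{\lambda}(g) = \frac{\det\left(x_{i}^{\lambda_j+m-j+\frac{1}{2}}-x_{i}^{-(\lambda_j+m-j+\frac{1}{2})} \right)_{1\le i,j\le m}}{\det\left(x_{i}^{m-j+\frac{1}{2}}-x_{i}^{-(m-j+\frac{1}{2})} \right)_{1\le i,j\le m}},$$ where $x_1,x_1^{-1},\ldots,x_m,x_m^{-1},1$ are the eigenvalues of $g$. *)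

(* Defs.v *)
From HB Require Import structures.
From mathcomp Require Import all_boot all_order all_algebra.
From mathcomp Require Import complex finmap.
From mathcomp Require Import all_classical all_reals all_analysis.
From mathcomp Require Import summability.

Set Implicit Arguments.
Unset Strict Implicit.
Unset Printing Implicit Defensive.

Import Order.TTheory GRing.Theory Num.Theory.
Import numFieldNormedType.Exports.

Local Open Scope classical_set_scope.
Local Open Scope ring_scope.

(* R[i] packed as a numClosedFieldType, so that it (and matrices over it)
   receives the topology of its norm. *)
Definition cplx (R : realType) : numClosedFieldType := R[i]%C.

Definition to_cplx (R : realType) (a : R) : cplx R := (a%:C)%C.

Definition SO (R : realType) (n : nat) : set 'M[R]_n :=
  [set g | g *m g^T = 1%:M /\ \det g = 1].
Arguments SO : clear implicits.

(* The eigenvalues of g, with multiplicity, are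
   x_1, x_1^-1, ..., x_m, x_m^-1, 1. *)
Definition so_eigenvalues (R : realType) (m : nat)
    (g : 'M[R]_(m.*2.+1)) (x : 'rV[cplx R]_m) : Prop :=
  char_poly (map_mx (@to_cplx R) g) =
  (\prod_(i < m) (('X - (x 0 i)%:P) * ('X - (x 0 i)^-1%:P))) * ('X - 1%:P).

(* Finite-dimensional continuous complex representations of SO(n); the values
   of rho outside SO(n) are irrelevant. *)
Definition so_repr (R : realType) (n d : nat)
    (rho : 'M[R]_n -> 'M[cplx R]_d) : Prop :=
  [/\ rho 1%:M = 1%:M,
      forall g h, SO R n g -> SO R n h -> rho (g *m h) = rho g *m rho h
    & {within SO R n, continuous rho}].

(* As in mxrepresentation, subspaces are row spaces and rho g acts on the
   right. *)
Definition so_irreducible (R : realType) (n d : nat)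
    (rho : 'M[R]_n -> 'M[cplx R]_d) : Prop :=
  (0 < d)%N /\
  forall U : 'M[cplx R]_d,
    (forall g, SO R n g -> stablemx U (rho g)) -> U = 0 \/ row_full U.

(* Partitions with at most m parts, padded with zeros to length m. *)
Definition mpartition (m : nat) := {l : m.-tuple nat | sorted geq l}.

Definition part (m : nat) (l : mpartition m) (j : 'I_m) : nat := tnth (val l) j.

Definition weight (m : nat) (l : mpartition m) : nat := (\sum_(j < m) part l j)%N.

(* det (x_i^(k_j + 1/2) - x_i^-(k_j + 1/2)), half-integer powers being odd
   powers of the principal square root. Another choice of square roots
   multiplies rows by signs independent of k, so it does not change quotients
   of two such determinants. *)
Definition half_det (R : realType) (m : nat)
    (k : 'I_m -> nat) (x : 'rV[cplx R]_m) : cplx R :=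
  \det (\matrix_(i < m, j < m)
          (sqrtC (x 0 i) ^+ (k j).*2.+1 - sqrtC (x 0 i) ^- (k j).*2.+1)).

(* With 0-based indices, lambda_j + m - j becomes part l j + (m - j.+1). *)
Definition weyl_num (R : realType) (m : nat) (l : mpartition m) :
    'rV[cplx R]_m -> cplx R :=
  half_det (fun j => part l j + (m - j.+1))%N.

Definition weyl_den (R : realType) (m : nat) : 'rV[cplx R]_m -> cplx R :=
  half_det (fun j => m - j.+1)%N.

(* chi is the irreducible character of SO(2m+1) labeled by l: the label is the
   one for which Weyl's formula holds at every g where its denominator does not
   vanish. The remaining values are those of the trace of the continuous
   representation rho. *)
Definition so_character (R : realType) (m : nat) (l : mpartition m)
    (chi : 'M[R]_(m.*2.+1) -> cplx R) : Prop :=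
  (exists (d : nat) (rho : 'M[R]_(m.*2.+1) -> 'M[cplx R]_d),
     [/\ so_repr rho, so_irreducible rho
       & forall g, SO R _ g -> chi g = \tr (rho g)]) /\
  (forall (g : 'M[R]_(m.*2.+1)) (x : 'rV[cplx R]_m),
     SO R _ g -> so_eigenvalues g x -> weyl_den x != 0 ->
     chi g = weyl_num l x / weyl_den x).

Definition torus (R : realType) (m : nat) : set 'rV[cplx R]_m :=
  [set x | forall i, `|x 0 i| = 1].
Arguments torus : clear implicits.

(* v is the value at p of the quotient N / D on the set A: the quotient itself
   if D p != 0, and otherwise its limit at p along the points of A where D does
   not vanish (removable singularity). *)
Definition quotient_value (T : topologicalType) (K : numClosedFieldType)
    (A : set T) (N D : T -> K) (p : T) (v : K) : Prop :=
  if D p != 0 then v = N p / D p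
  else N q / D q @[q --> within (A `&` [set q | D q != 0]) (nbhs p)] --> v.

Definition cauchy_mx (R : realType) (m : nat) (z : cplx R)
    (x y : 'rV[cplx R]_m) : 'M[cplx R]_m :=
  \matrix_(i < m, j < m)
    (((1 + z) ^+ 2 + z * (x 0 i + (x 0 i)^-1 + y 0 j + (y 0 j)^-1)) /
     ((1 - z * x 0 i * y 0 j) * (1 - z * (x 0 i)^-1 * y 0 j) *
      (1 - z * x 0 i * (y 0 j)^-1) * (1 - z * (x 0 i)^-1 * (y 0 j)^-1))).

Definition vdm (R : realType) (m : nat) (x : 'rV[cplx R]_m) : cplx R :=
  \prod_(i < m) \prod_(j < m | (i < j)%N)
    (x 0 i + (x 0 i)^-1 - (x 0 j + (x 0 j)^-1)).

(* Main.v *)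
Require Import Defs.
From HB Require Import structures.
From mathcomp Require Import all_boot all_order all_algebra.
From mathcomp Require Import complex finmap.
From mathcomp Require Import all_classical all_reals all_analysis.
From mathcomp Require Import summability.
From mathcomp Require Import fingroup perm.
From mathcomp Require Import ring lra zify.
Import Order.TTheory GRing.Theory Num.Theory.
Import numFieldNormedType.Exports.
Local Open Scope classical_set_scope.
Local Open Scope ring_scope.

(** Put u_i = x_i + 1/x_i. The entries of Weyl's numerator are, up to a common
    factor in each row, values at u_i of the polynomials p_k with generating
    series (1 + t) / (1 - u t + t^2). Newton interpolation at u_1, ..., u_m factors
    the matrix (p_k(u_i)) into a triangular matrix with Vandermonde determinant
    and the matrix E(x) of divided differences, so so_lambda(g) is, up to a sign,
    a minor of E(x), at singular g as well by continuity along the maximal torus.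
    By Cauchy-Binet the sum over lambda becomes z^-C(m,2) det G, where
    G_ij = sum_k z^k E_ik(x) E_jk(y). The divided differences grow slower than any
    exponential rho^k with rho > 1, uniformly on the torus, hence everything
    converges absolutely and det G is continuous in (x, y). Multiplying G by the
    two triangular matrices gives the kernel sum_k z^k p_k(u_i) p_k(v_j), which
    telescopes to (1 - z) C_ij. *)

(** Where eigenvalues collide, both Weyl's quotient and the right-hand side become 0/0. The divided
    differences are built by a recursion that never divides by a difference of nodes, so the minors
    and det G make sense at every torus point; the two quotients are compared with them at regular
    points only, and then passed to the limit. For a character this limit runs through the group
    itself: a singular g is conjugated into the maximal torus, which needs the real normal form of
    an orthogonal matrix with prescribed eigenvalues. Coinciding nodes give multiple poles on the
    unit circle, hence polynomial growth in k. A rate rho > 1 with z rho^2 < 1 absorbs it, the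
    square coming from the two divided differences in each kernel term. The power z^C(m,2) is the
    excess of the sum of the exponents lambda_j + m - j over |lambda|. *)

Set Implicit Arguments.
Unset Strict Implicit.
Unset Printing Implicit Defensive.

(** * Newton interpolation of the odd SO(3) characters by generating series *)

Section NewtonExpansion.
Variable F : fieldType.
Implicit Types (a x y z : F) (f : nat -> F).

(* Coefficients of [f(t) / (1 - a t)]. *)
Fixpoint geo a f k : F :=
  if k is k'.+1 then a * geo a f k' + f k'.+1 else f 0%N.

(* Coefficients of [f(t) / (1 - (x + x^-1) t + t^2)]. *)
Definition quad x f : nat -> F := geo x^-1 (geo x f).

Definition shift f k : F := if k is k'.+1 then f k' else 0.

Definition init k : F := (k <= 1)%:R.

Definition recip_sum x : F := x + x^-1.

(* The odd character [x^k + x^(k-1) + ... + x^-k] of SO(3), by its generating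
   series [(1 + t) / (1 - (x + x^-1) t + t^2)]. *)
Definition odd_char x : nat -> F := quad x init.

(* [ddiff xs l k] is the divided difference of [odd_char _ k], a polynomial in
   [x + x^-1], at the nodes [xs 0, ..., xs l]: its generating series is
   [(1 + t) t^l / prod_(p <= l) (1 - (xs p + (xs p)^-1) t + t^2)]. *)
Fixpoint ddiff (xs : nat -> F) l : nat -> F :=
  quad (xs l) (if l is l'.+1 then shift (ddiff xs l') else init).

Definition ddiff_src (xs : nat -> F) l : nat -> F :=
  if l is l'.+1 then shift (ddiff xs l') else init.

Lemma ddiffE xs l : ddiff xs l = quad (xs l) (ddiff_src xs l).
Proof. by case: l. Qed.

Lemma quad0 x f : quad x f 0 = f 0%N. Proof. by []. Qed.

Lemma quad1 x f : quad x f 1 = recip_sum x * f 0%N + f 1%N.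
Proof. by rewrite /quad /recip_sum /=; ring. Qed.

Lemma quadSS x f k : x != 0 ->
  quad x f k.+2 = recip_sum x * quad x f k.+1 - quad x f k + f k.+2.
Proof. by move=> x0; rewrite /quad /recip_sum /=; field. Qed.

Lemma quad_unique x f q : x != 0 -> q 0%N = f 0%N ->
  q 1%N = recip_sum x * f 0%N + f 1%N ->
  (forall k, q k.+2 = recip_sum x * q k.+1 - q k + f k.+2) -> q =1 quad x f.
Proof.
move=> x0 q0 q1 qSS k; suff [] : q k = quad x f k /\ q k.+1 = quad x f k.+1 by [].
elim: k => [|k [IH IHS]]; first by rewrite q0 q1 quad1.
by split=> //; rewrite qSS quadSS // IH IHS.
Qed.

(* [1/Q_y - 1/Q_x = t (u_y - u_x) / (Q_x Q_y)] with [Q_x = 1 - u_x t + t^2]. *)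
Lemma quad_change x y f k : x != 0 -> y != 0 ->
  quad y f k =
  quad x f k + (recip_sum y - recip_sum x) * quad y (shift (quad x f)) k.
Proof.
move=> x0 y0; symmetry; move: k; apply: quad_unique => // [||k].
- by rewrite !quad0 /=; ring.
- by rewrite !quad1 /shift quad0; ring.
by rewrite !quadSS // /shift; ring.
Qed.

(** Newton's formula with remainder: each step applies [quad_change] to the remainder, trading its
    node [y] for [xs n]. No difference of nodes is inverted, so nodes may coincide. *)
Lemma odd_char_newton (xs : nat -> F) y n k :
  (forall l, xs l != 0) -> y != 0 ->
  odd_char y k =
  \sum_(l < n) (\prod_(p < l) (recip_sum y - recip_sum (xs p))) * ddiff xs l k
  + (\prod_(p < n) (recip_sum y - recip_sum (xs p))) * quad y (ddiff_src xs n) k.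
Proof.
move=> xs0 y0; elim: n => [|n IH]; first by rewrite !big_ord0 add0r mul1r.
rewrite IH big_ord_recr big_ord_recr /= -addrA; congr (_ + _).
by rewrite -mulrA -mulrDr ddiffE -quad_change.
Qed.

(** At one of the first [n] nodes the remainder contains the zero factor [p = i]. *)
Lemma odd_char_ddiff (xs : nat -> F) n (i : 'I_n) k :
  (forall l, xs l != 0) ->
  odd_char (xs i) k =
  \sum_(l < n) (\prod_(p < l) (recip_sum (xs i) - recip_sum (xs p))) * ddiff xs l k.
Proof.
move=> xs0; rewrite (odd_char_newton n _ xs0) //.
by rewrite [X in _ + X * _](bigD1 i) //= subrr !mul0r addr0.
Qed.

Lemma geo_lower a f l : (forall k, (k < l)%N -> f k = 0) ->
  (forall k, (k < l)%N -> geo a f k = 0) /\ geo a f l = f l.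
Proof.
move=> f0; have geo0 k : (k < l)%N -> geo a f k = 0.
  by elim: k => [|k IH] kl /=; [exact: f0 | rewrite IH ?f0 ?mulr0 ?addr0 // ltnW].
by split=> //; case: l f0 geo0 => [|l] f0 geo0 //=; rewrite geo0 // mulr0 add0r.
Qed.

Lemma quad_lower x f l : (forall k, (k < l)%N -> f k = 0) ->
  (forall k, (k < l)%N -> quad x f k = 0) /\ quad x f l = f l.
Proof.
move=> f0; have [g0 gl] := geo_lower x f0.
by have [q0 ql] := geo_lower x^-1 g0; rewrite /quad ql gl.
Qed.

(** The numerator [(1 + t) t^l] makes [t^l] the leading term; hence the square matrix with exponents
    [0, ..., m - 1] is unitriangular. *)
Lemma ddiff_lower xs l :
  (forall k, (k < l)%N -> ddiff xs l k = 0) /\ ddiff xs l l = 1.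
Proof.
elim: l => [|l [IH0 IH1]]; first by split.
rewrite ddiffE; have [|q0 ->] := @quad_lower (xs l.+1) (ddiff_src xs l.+1) l.+1.
  by case=> // k; rewrite ltnS; exact: IH0.
by split.
Qed.

Lemma odd_char0 x : odd_char x 0 = 1. Proof. by []. Qed.

Lemma odd_char1 x : odd_char x 1 = recip_sum x + 1.
Proof. by rewrite /odd_char quad1 mulr1. Qed.

Lemma odd_charSS x k : x != 0 ->
  odd_char x k.+2 = recip_sum x * odd_char x k.+1 - odd_char x k.
Proof. by move=> x0; rewrite /odd_char quadSS // addr0. Qed.

(** With [s] a square root of [x], dividing by [s - s^-1] would turn half-integer powers into a
    polynomial in [x + x^-1]; the multiplied form also covers [s = s^-1]. *)
Lemma half_power_odd_char (s : F) k : s != 0 ->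
  s ^+ k.*2.+1 - s ^- k.*2.+1 = (s - s^-1) * odd_char (s ^+ 2) k.
Proof.
move=> s0; have s20 : s ^+ 2 != 0 by rewrite expf_neq0.
suff [] : s ^+ k.*2.+1 - s ^- k.*2.+1 = (s - s^-1) * odd_char (s ^+ 2) k /\
  s ^+ k.+1.*2.+1 - s ^- k.+1.*2.+1 = (s - s^-1) * odd_char (s ^+ 2) k.+1 by [].
elim: k => [|k [IH IHS]].
  rewrite odd_char1 odd_char0 /recip_sum !expr1 mulr1; split=> //=.
  by rewrite (_ : 1.*2.+1 = 3)%N //; field.
split=> //; rewrite odd_charSS // mulrBr mulrCA -IH -IHS /recip_sum.
rewrite !doubleS !exprS; have := expf_neq0 k.*2 s0.
by move: (s ^+ k.*2) => t t0; field; rewrite ?s0 ?t0.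
Qed.

(** The bilinear form T solving [T_k - z T_(k+1) = cauchy_den * a_k * b_k] when both sequences
    satisfy [a_(k+2) = u a_(k+1) - a_k] (with [v] for [b]). This is a 4 x 4 linear system of
    determinant [cauchy_den], which explains the polynomial coefficients. *)
Definition tele_coef z u v (a a' b b' : F) : F :=
  (1 - z ^+ 2 - z ^+ 3 * u * v + z ^+ 2 * (u ^+ 2 + v ^+ 2) - z * u * v) * (a * b)
  + z ^+ 2 * (z * u - v) * (a * b') + z ^+ 2 * (z * v - u) * (a' * b)
  + z * (1 - z ^+ 2) * (a' * b').

Definition cauchy_den z x y : F :=
  (1 - z * x * y) * (1 - z * x^-1 * y) * (1 - z * x * y^-1) * (1 - z * x^-1 * y^-1).

(* The partial sums of the Cauchy kernel telescope: [z^k a_k b_k] is, up to the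
   factor [cauchy_den], the difference of a bilinear form in the consecutive
   terms [a_k, a_(k+1)] and [b_k, b_(k+1)]. *)
Lemma cauchy_kernel_partial z x y K : x != 0 -> y != 0 ->
  cauchy_den z x y * \sum_(k < K) z ^+ k * odd_char x k * odd_char y k =
  (1 - z) * ((1 + z) ^+ 2 + z * (x + x^-1 + y + y^-1)) -
  z ^+ K * tele_coef z (recip_sum x) (recip_sum y)
    (odd_char x K) (odd_char x K.+1) (odd_char y K) (odd_char y K.+1).
Proof.
(* Written in the two reciprocal sums, the denominator contains no inverse, and telescoping becomes
   a polynomial identity. *)
move=> x0 y0; have -> : cauchy_den z x y = 1 - z * recip_sum x * recip_sum y
    + z ^+ 2 * (recip_sum x ^+ 2 + recip_sum y ^+ 2 - 2)
    - z ^+ 3 * recip_sum x * recip_sum y + z ^+ 4.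
  by rewrite /cauchy_den /recip_sum; field; rewrite ?x0 ?y0.
rewrite -(addrA _ y) (_ : x + x^-1 + _ = recip_sum x + recip_sum y) //.
elim: K => [|K IH].
  rewrite big_ord0 mulr0 /tele_coef !odd_char1 !odd_char0 expr0.
  by move: (recip_sum x) (recip_sum y) => u v; ring.
rewrite big_ord_recr /= mulrDr IH /tele_coef !odd_charSS // (exprS z K).
move: (recip_sum x) (recip_sum y) (odd_char x K) (odd_char y K) (z ^+ K).
move: (odd_char x K.+1) (odd_char y K.+1) => a' b' u v a b t.
ring.
Qed.

Definition newton_mx m (xs : nat -> F) : 'M[F]_m :=
  \matrix_(i, l) \prod_(p < l) (recip_sum (xs i) - recip_sum (xs p)).

Definition ddiff_mx m n (xs : nat -> F) (k : 'I_n -> nat) : 'M[F]_(m, n) :=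
  \matrix_(l, j) ddiff xs l (k j).

Lemma odd_char_mxE m n (xs : nat -> F) (k : 'I_n -> nat) :
  (forall l, xs l != 0) ->
  \matrix_(i < m, j < n) odd_char (xs i) (k j) = newton_mx m xs *m ddiff_mx m xs k.
Proof.
move=> xs0; apply/matrixP => i j; rewrite !mxE (odd_char_ddiff i _ xs0).
by apply: eq_bigr => l _; rewrite !mxE.
Qed.

Lemma det_newton_mx m (xs : nat -> F) :
  \det (newton_mx m xs) =
  \prod_(i < m) \prod_(p < i) (recip_sum (xs i) - recip_sum (xs p)).
Proof.
rewrite det_trig; first by apply: eq_bigr => i _; rewrite mxE.
apply/is_trig_mxP => i j ij; rewrite mxE (bigD1 (Ordinal ij)) //=.
by rewrite subrr mul0r.
Qed.

Lemma ddiff_mx_rev m (xs : nat -> F) :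
  ddiff_mx m xs (fun j : 'I_m => m - j.+1)%N =
  col_perm (perm rev_ord_inj) (ddiff_mx m xs (fun j : 'I_m => j : nat)).
Proof. by apply/matrixP => i j; rewrite !mxE permE. Qed.

Lemma det_ddiff_mx_id m (xs : nat -> F) :
  \det (ddiff_mx m xs (fun j : 'I_m => j : nat)) = 1.
Proof.
rewrite -det_tr det_trig; last first.
  apply/is_trig_mxP => i j ij; rewrite !mxE.
  by have [/(_ i)->] := ddiff_lower xs j.
by apply: big1 => i _; rewrite !mxE; have [_ ->] := ddiff_lower xs i.
Qed.

(** The exponents [m - 1, ..., 0] of Weyl's denominator give the unitriangular matrix with its
    columns reversed; this sign is all that remains of that minor. *)
Lemma det_ddiff_mx_rev m (xs : nat -> F) :
  \det (ddiff_mx m xs (fun j : 'I_m => m - j.+1)%N) =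
  (-1) ^+ (perm (@rev_ord_inj m)).
Proof.
by rewrite ddiff_mx_rev col_permE det_mulmx det_ddiff_mx_id det_perm mul1r odd_permV.
Qed.

End NewtonExpansion.

(** The coefficients of [f(t) / (1 - a t)] are dominated by [M (r^k + r^(k-1) + ... + 1)], a
    geometric sum of ratio [r^-1]. *)
Lemma geo_bound (K : numFieldType) (a : K) (f : nat -> K) (M r : K) :
  `|a| <= 1 -> 1 < r -> (forall k, `|f k| <= M * r ^+ k) ->
  forall k, `|geo a f k| <= M * (1 - r^-1)^-1 * r ^+ k.
Proof.
move=> a1 r1 fM; have r0 : 0 < r by apply: lt_trans r1.
have q0 : 0 < 1 - r^-1 by rewrite subr_gt0 invf_lt1.
have M0 : 0 <= M by have := le_trans (normr_ge0 _) (fM 0%N); rewrite expr0 mulr1.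
elim=> [|k IH] /=.
  apply: le_trans (fM 0%N) _; rewrite expr0 !mulr1 ler_peMr // invf_ge1 // gerBl.
  by rewrite invr_ge0 ltW.
apply: le_trans (ler_normD _ _) _.
have -> : M * (1 - r^-1)^-1 * r ^+ k.+1 =
   M * (1 - r^-1)^-1 * r ^+ k + M * r ^+ k.+1.
  have rB : r - 1 != 0 by rewrite subr_eq0 gt_eqF.
  by rewrite exprS; field; rewrite rB gt_eqF.
apply: lerD => //; rewrite normrM; apply: le_trans IH.
by rewrite ler_piMl.
Qed.

(** [quad] applies [geo] twice, at the cost of a factor [c] each time. [M] is chosen before the
    nodes: the continuity of the kernel rests on this uniformity. *)
Lemma ddiff_bound (K : numFieldType) (r : K) (l : nat) : 1 < r ->
  exists M : K, forall xs : nat -> K, (forall l, `|xs l| = 1) ->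
    forall k, `|ddiff xs l k| <= M * r ^+ k.
Proof.
move=> r1; have r0 : 0 < r by apply: lt_trans r1.
pose c := (1 - r^-1)^-1.
have quadM x f M : `|x| = 1 -> (forall k, `|f k| <= M * r ^+ k) ->
    forall k, `|quad x f k| <= M * c * c * r ^+ k.
  move=> x1 fM; apply: geo_bound; rewrite ?normfV ?x1 ?invr1 //.
  by apply: geo_bound; rewrite ?x1.
elim: l => [|l [M IH]].
  exists (1 * c * c) => xs xs1; apply: quadM => // k; rewrite mul1r /init.
  apply: le_trans (exprn_ege1 _ (ltW r1)).
  by rewrite normr_nat lern1 leq_b1.
exists (M * c * c) => xs xs1; apply: quadM => // -[|k] /=.
  rewrite normr0 expr0 mulr1.
  by have := le_trans (normr_ge0 _) (IH xs xs1 0%N); rewrite expr0 mulr1.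
apply: le_trans (IH xs xs1 k) _; rewrite exprS ler_wpM2l //; last first.
  by rewrite ler_peMl ?exprn_ge0 ?ltW.
by have := le_trans (normr_ge0 _) (IH xs xs1 0%N); rewrite expr0 mulr1.
Qed.

(** * The Cauchy-Binet formula *)

Section CauchyBinet.
Local Open Scope set_scope.
Variables (F : comNzRingType) (m K : nat).
Implicit Types (k f : {ffun 'I_m -> 'I_K}) (A : 'M[F]_(m, K)) (B : 'M[F]_(K, m)).

(** Decreasing maps stand for the m-element sets of columns; this order is that of the exponents
    [lambda_j + m - j] of a partition. *)
Definition decreasing k := [forall i : 'I_m, forall j : 'I_m, (i < j)%N ==> (k j < k i)%N].

Lemma decreasingP k :
  reflect (forall i j : 'I_m, (i < j)%N -> (k j < k i)%N) (decreasing k).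
Proof. by apply: (iffP 'forall_'forall_implyP). Qed.

Lemma decreasing_inj k : decreasing k -> injective k.
Proof.
move=> /decreasingP kd i j kij; apply/val_inj.
by case: (ltngtP i j) => // /kd; rewrite kij ltnn.
Qed.

Definition permuted_fun (p : {ffun 'I_m -> 'I_K} * 'S_m) : {ffun 'I_m -> 'I_K} :=
  [ffun i => p.1 (p.2 i)].

Let rle (a b : 'I_K) := (b <= a)%N.

Lemma sorted_decreasing k : decreasing k -> sorted rle (mktuple k).
Proof.
move=> /decreasingP kd; rewrite /= /image_mem.
apply: (@homo_sorted _ _ k (fun i j : 'I_m => (i < j)%N)).
  by move=> i j /kd /ltnW.
by have := iota_ltn_sorted 0 m; rewrite -val_enum_ord sorted_map.
Qed.

(** A decreasing map is the sorted list of its values, which permuting does not change; its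
    injectivity then determines the permutation. *)
Lemma permuted_fun_inj :
  {in [set p | decreasing p.1] &, injective permuted_fun}.
Proof.
move=> [k s] [k' s']; rewrite !inE /= => kd kd' E.
have pk (l : {ffun 'I_m -> 'I_K}) (r : 'S_m) :
    perm_eq (mktuple (permuted_fun (l, r))) (mktuple l).
  apply/tuple_permP; exists r; congr val; apply: eq_mktuple => i.
  by rewrite ffunE tnth_mktuple.
have tk : mktuple k = mktuple k'.
  apply/val_inj; apply: (@sorted_eq _ rle) => /=.
  - by move=> a b c; rewrite /rle => ab ca; apply: leq_trans ca ab.
  - by move=> a b; rewrite /rle andbC -eqn_leq => /eqP /val_inj.
  - exact: sorted_decreasing.
  - exact: sorted_decreasing.
  have := pk k s; rewrite perm_sym => h; apply: perm_trans h _.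
  by rewrite E; exact: pk.
have kk : k = k' by apply/ffunP => i; rewrite -(tnth_mktuple k) tk tnth_mktuple.
rewrite -kk in E *; congr (_, _); apply/permP => i.
by apply: (decreasing_inj kd); have /ffunP/(_ i) := E; rewrite !ffunE.
Qed.

(** Sorting the values of an injective map yields both the decreasing map and the permutation. *)
Lemma permuted_fun_im :
  permuted_fun @: [set p | decreasing p.1] = [set f : {ffun 'I_m -> 'I_K} | injectiveb f].
Proof.
apply/setP => f; rewrite inE; apply/imsetP/idP => [[[k s]]|/injectiveP finj].
  rewrite inE /= => kd ->; apply/injectiveP => i j; rewrite !ffunE /=.
  by move=> /(decreasing_inj kd) /perm_inj.
pose t := sort_tuple rle (mktuple f).
have /tuple_permP[s fs] : perm_eq (mktuple f) t by rewrite perm_sym /= perm_sort.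
have {fs}fs i : f i = tnth t (s i).
  by rewrite -(tnth_mktuple f) (val_inj fs) tnth_mktuple.
have tinj : injective (tnth t).
  move=> i j; have := fs ((s^-1)%g i); have := fs ((s^-1)%g j); rewrite !permKV => <- <- /finj.
  exact: perm_inj.
exists ([ffun i => tnth t i], s); last by apply/ffunP => i; rewrite ffunE /= ffunE fs.
rewrite inE; apply/decreasingP => i j ij; rewrite !ffunE ltn_neqAle; apply/andP; split.
  by apply: contraTneq ij => /val_inj /tinj ->; rewrite ltnn.
have rtr : transitive rle by move=> a b c; rewrite /rle => ab ca; apply: leq_trans ca ab.
have rtot : total rle by move=> a b; exact: leq_total.
have x0 := tnth t i; rewrite !(tnth_nth x0).
apply: (@sorted_ltn_nth _ rle rtr x0) => //.
- by rewrite /t /= sort_sorted.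
- by rewrite inE size_tuple.
- by rewrite inE size_tuple.
Qed.

(** Multilinearity in the rows: row [i] of the product is a combination of rows of [B], and [f i] is
    the row selected. *)
Lemma det_mulmx_ffun A B :
  \det (A *m B) = \sum_(f : {ffun 'I_m -> 'I_K}) (\prod_i A i (f i)) * \det (rowsub f B).
Proof.
rewrite /determinant.
transitivity (\sum_(s : 'S_m) \sum_(f : {ffun 'I_m -> 'I_K})
  (-1) ^+ s * \prod_i (A i (f i) * B (f i) (s i))).
  apply: eq_bigr => s _; rewrite -big_distrr /=; congr (_ * _).
  rewrite -(bigA_distr_bigA (fun i j => A i j * B j (s i))).
  by apply: eq_bigr => i _; rewrite mxE.
rewrite exchange_big; apply: eq_bigr => f _ /=; rewrite big_distrr /=.
apply: eq_bigr => s _; rewrite big_split /= mulrCA; congr (_ * (_ * _)).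
by apply: eq_bigr => i _; rewrite mxE.
Qed.

(** A non-injective selection repeats a row of [B] and contributes zero. The injective ones over a
    given decreasing map sum, with the signs of their permutations, to the minor of [A]. *)
Lemma cauchy_binet A B :
  \det (A *m B) =
  \sum_(k : {ffun 'I_m -> 'I_K} | decreasing k) \det (colsub k A) * \det (rowsub k B).
Proof.
rewrite det_mulmx_ffun (bigID (fun f => injectiveb f)) /= addrC big1 => [|f].
  rewrite add0r (eq_bigl (mem (permuted_fun @: [set p | decreasing p.1]))); last first.
    by move=> f; rewrite /= permuted_fun_im inE.
  rewrite (big_imset _ permuted_fun_inj) /=.
  transitivity (\sum_(k : {ffun 'I_m -> 'I_K} | decreasing k) \sum_(s : 'S_m)
      (\prod_i A i (permuted_fun (k, s) i)) * \det (rowsub (permuted_fun (k, s)) B)).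
    by rewrite pair_big_dep /=; apply: eq_big => [[k s]|[k s] _]; rewrite ?inE ?andbT.
  apply: eq_bigr => k _; rewrite [in RHS]/determinant big_distrl /=.
  apply: eq_bigr => s _.
  have -> : rowsub (permuted_fun (k, s)) B = row_perm s (rowsub k B).
    by apply/matrixP => i j; rewrite !mxE ffunE.
  rewrite row_permE det_mulmx det_perm mulrCA mulrA; congr (_ * _ * _).
  by apply: eq_bigr => i _; rewrite mxE ffunE.
move=> /injectivePn[i [j ij fij]].
rewrite (@determinant_alternate _ _ _ i j) ?mulr0 // => l.
by rewrite !mxE fij.
Qed.

End CauchyBinet.

(** * Invariant planes of real orthogonal matrices *)

Section RealOrthogonal.
Variable R : rcfType.
Implicit Types (N n k : nat).

Definition dot N (a b : 'rV[R]_N) : R := (a *m b^T) 0 0.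

Lemma dot_mxE N (a b : 'rV[R]_N) : a *m b^T = (dot a b)%:M.
Proof. exact: mx11_scalar. Qed.

Lemma dotC N (a b : 'rV[R]_N) : dot a b = dot b a.
Proof. by rewrite /dot -[b in RHS]trmxK -trmx_mul [RHS]mxE. Qed.

Lemma dot_comb N (a b c d : 'rV[R]_N) (p q r s : R) :
  dot (p *: a + q *: b) (r *: c + s *: d) =
  p * r * dot a c + p * s * dot a d + q * r * dot b c + q * s * dot b d.
Proof.
rewrite /dot linearD !linearZ /= mulmxDl !mulmxDr -!scalemxAl -!scalemxAr.
by rewrite !mxE; ring.
Qed.

Lemma dotZZ N (a b : 'rV[R]_N) p r : dot (p *: a) (r *: b) = p * r * dot a b.
Proof. by have := dot_comb a 0 b 0 p 0 r 0; rewrite !scale0r !addr0 => ->; ring. Qed.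

Lemma dot_sum N (a : 'rV[R]_N) : dot a a = \sum_i a 0 i ^+ 2.
Proof. by rewrite /dot mxE; apply: eq_bigr => i _; rewrite mxE. Qed.

Lemma dot_ge0 N (a : 'rV[R]_N) : 0 <= dot a a.
Proof. by rewrite dot_sum sumr_ge0 // => i _; exact: sqr_ge0. Qed.

Lemma dot_eq0 N (a : 'rV[R]_N) : (dot a a == 0) = (a == 0).
Proof.
apply/eqP/eqP => [|->]; last by rewrite /dot mul0mx mxE.
rewrite dot_sum => /eqP; rewrite psumr_eq0 => [/allP a0|i _]; last exact: sqr_ge0.
apply/rowP => i; rewrite mxE; apply/eqP; rewrite -sqrf_eq0.
by apply: a0; rewrite mem_index_enum.
Qed.

Lemma dot_isometry N (g : 'M[R]_N) (a b : 'rV[R]_N) :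
  g *m g^T = 1%:M -> dot (a *m g) (b *m g) = dot a b.
Proof. by move=> gg; rewrite /dot trmx_mul mulmxA -(mulmxA a) gg mulmx1. Qed.

Lemma normalize N (a : 'rV[R]_N) : a != 0 -> exists2 s, s != 0 & dot (s *: a) (s *: a) = 1.
Proof.
move=> a0; have d0 : 0 < dot a a by rewrite lt_neqAle dot_ge0 eq_sym dot_eq0 a0.
exists (Num.sqrt (dot a a))^-1; first by rewrite invr_eq0 gt_eqF ?sqrtr_gt0.
by rewrite dotZZ -expr2 exprVn sqr_sqrtr ?mulVf ?gt_eqF ?ltW.
Qed.

(** Gram-Schmidt, one row at a time: while [k < N] the kernel of [Q^T] contains a nonzero vector, to
    be normalized and appended. *)
Lemma orthonormal_completion n k N (Q : 'M[R]_(k, N)) :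
  Q *m Q^T = 1%:M -> (k + n)%N = N ->
  exists W : 'M[R]_(n, N), W *m W^T = 1%:M /\ Q *m W^T = 0.
Proof.
elim: n k Q => [|n IH] k Q QQ kN.
  exists 0; rewrite trmx0 !mulmx0; split=> //; apply/matrixP => i. by case: i.
have : kermx Q^T != 0.
  rewrite -mxrank_eq0 mxrank_ker subn_eq0 -ltnNge.
  apply: leq_ltn_trans (rank_leq_col _) _. by rewrite -kN addnS ltnS leq_addr.
rewrite -nz_row_eq0; set v := nz_row _ => v0.
have vQ : v *m Q^T = 0 by apply/sub_kermxP; exact: nz_row_sub.
have [s _ sv] := normalize v0.
pose w := s *: v; have wQ : w *m Q^T = 0 by rewrite -scalemxAl vQ scaler0.
have [||W [WW QW]] := IH (k + 1)%N (col_mx Q w).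
- rewrite tr_col_mx mul_col_row QQ wQ dot_mxE sv.
  by rewrite -[Q *m w^T]trmxK trmx_mul trmxK wQ trmx0 -scalar_mx_block.
- by rewrite -addnA.
suff : let X := col_mx w W in X *m X^T = 1%:M /\ Q *m X^T = 0 by exists (col_mx w W).
move: QW; rewrite /= mul_col_mx -(col_mx0 _ k 1) => /eq_col_mx[QW wW].
have Ww : W *m w^T = 0 by rewrite -[LHS]trmxK trmx_mul trmxK wW trmx0.
have Qw : Q *m w^T = 0 by rewrite -[LHS]trmxK trmx_mul trmxK wQ trmx0.
rewrite tr_col_mx mul_col_row mul_mx_row WW wW QW dot_mxE sv Ww Qw row_mx0.
by split=> //; rewrite -scalar_mx_block.
Qed.

(** [r] is orthogonal too, so the row space of [Q] is invariant under [g^T = g^-1] as well;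
    therefore [g] preserves its orthogonal complement, spanned by [W]. *)
Lemma orthogonal_block k n (g : 'M[R]_(k + n)) (Q : 'M[R]_(k, k + n)) (r : 'M[R]_k) :
  g *m g^T = 1%:M -> Q *m Q^T = 1%:M -> Q *m g = r *m Q ->
  exists (W : 'M[R]_(n, k + n)) (g' : 'M[R]_n),
  [/\ col_mx Q W *m (col_mx Q W)^T = 1%:M, g' *m g'^T = 1%:M
    & col_mx Q W *m g = block_mx r 0 0 g' *m col_mx Q W].
Proof.
move=> gg QQ Qg; have [W [WW QW]] := orthonormal_completion QQ erefl.
have WQ : W *m Q^T = 0 by rewrite -[LHS]trmxK trmx_mul trmxK QW trmx0.
have PP : col_mx Q W *m (col_mx Q W)^T = 1%:M.
  by rewrite tr_col_mx mul_col_row QQ WW QW WQ -scalar_mx_block.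
have gg' : g^T *m g = 1%:M by exact: mulmx1C.
have rr : r *m r^T = 1%:M.
  rewrite -[r in X in X *m _]mulmx1 -QQ mulmxA -mulmxA -trmx_mul -Qg.
  by rewrite trmx_mul mulmxA -(mulmxA Q) gg mulmx1.
have QgT : Q *m g^T = r^T *m Q.
  rewrite -[RHS]mulmx1 -gg !mulmxA -(mulmxA r^T) Qg mulmxA.
  by rewrite (mulmx1C rr) mul1mx.
have WgQ : W *m g *m Q^T = 0.
  have -> : W *m g *m Q^T = W *m (Q *m g^T)^T by rewrite trmx_mul trmxK mulmxA.
  by rewrite QgT trmx_mul trmxK mulmxA WQ mul0mx.
have QgW : Q *m g *m W^T = 0 by rewrite Qg -mulmxA QW mulmx0.
have P1 : Q^T *m Q + W^T *m W = 1%:M.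
  by have := mulmx1C PP; rewrite tr_col_mx mul_row_col.
have Wg : W *m g = W *m g *m W^T *m W.
  by rewrite -[LHS]mulmx1 -P1 mulmxDr !mulmxA WgQ mul0mx add0r.
exists W, (W *m g *m W^T); split=> //.
  move: Wg; set g' := _ *m W^T => Wg.
  rewrite -[g' in X in X *m _]mulmx1 -WW mulmxA -mulmxA -trmx_mul -Wg.
  by rewrite trmx_mul mulmxA -(mulmxA W) gg mulmx1.
by rewrite mul_col_mx mul_block_col !mul0mx addr0 add0r -Wg Qg.
Qed.

(* Real and imaginary parts [a], [b] of an eigenvector for [p + i q]. *)
Definition eigenpair N (g : 'M[R]_N) (p q : R) (a b : 'rV[R]_N) :=
  a *m g = p *: a - q *: b /\ b *m g = q *: a + p *: b.

(** Adding the isometry relations for [a] and [b] cancels the cross terms. *)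
Lemma eigenpair_norm N (g : 'M[R]_N) p q a b :
  g *m g^T = 1%:M -> eigenpair g p q a b -> (a != 0) || (b != 0) ->
  p ^+ 2 + q ^+ 2 = 1.
Proof.
move=> gg [ag bg] ab0; have := dot_isometry b b gg; have := dot_isometry a a gg.
rewrite ag bg -scaleNr !dot_comb (dotC b a) => aa bb.
have pos : 0 < dot a a + dot b b.
  by rewrite lt_neqAle eq_sym paddr_eq0 ?addr_ge0 ?dot_ge0 // !dot_eq0 negb_and ab0.
have : (p ^+ 2 + q ^+ 2 - 1) * (dot a a + dot b b) = 0.
  by move: (dot a a) (dot a b) (dot b b) aa bb => u v w aa bb; lra.
by move/eqP; rewrite mulf_eq0 (gt_eqF pos) orbF subr_eq0 => /eqP.
Qed.

Definition rot2 (p q : R) : 'M[R]_(1 + 1) := block_mx p%:M (- q)%:M q%:M p%:M.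

(** For [v = a + i b] and [c = p + i q], orthogonality gives [(c^2 - 1) (v . v) = 0], and [c^2 != 1]
    because [q != 0]. So [v . v = 0]: [a] and [b] are orthogonal and of equal length. The proof does
    this in real coordinates. *)
Lemma plane_nonreal N (g : 'M[R]_N) p q a b :
  g *m g^T = 1%:M -> eigenpair g p q a b -> (a != 0) || (b != 0) -> q != 0 ->
  exists Q : 'M[R]_(1 + 1, N), Q *m Q^T = 1%:M /\ Q *m g = rot2 p q *m Q.
Proof.
move=> gg gab ab0 q0; have pq := eigenpair_norm gg gab ab0.
have [ag bg] := gab.
have := dot_isometry a b gg; have := dot_isometry a a gg.
rewrite ag bg -scaleNr !dot_comb (dotC b a) => aa ab.
have e1 : q * (dot a a - dot b b) = - 2 * p * dot a b.
  apply: (mulfI q0); move: (dot a a) (dot a b) (dot b b) aa ab => u v w aa ab.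
  have := congr1 ( *%R^~ u) pq; lra.
have ab_0 : dot a b = 0.
  move: (dot a a) (dot a b) (dot b b) aa ab e1 => u v w aa ab e1.
  by have := congr1 ( *%R^~ v) pq; have := congr1 ( *%R p) e1; lra.
have abE : dot a a = dot b b.
  by apply/eqP; rewrite -subr_eq0 -(mulrI_eq0 _ (mulfI q0)) e1 ab_0 mulr0.
have a0 : a != 0.
  by move: ab0; rewrite -(dot_eq0 a) -(dot_eq0 b) abE orbb.
have [s s0 sa] := normalize a0.
exists (col_mx (s *: a) (s *: b) : 'M[R]_(1 + 1, N)); split.
  rewrite tr_col_mx mul_col_row !dot_mxE (dotC _ (s *: a)) sa.
  have -> : dot (s *: b) (s *: b) = 1 by rewrite -sa !dotZZ abE.
  by rewrite dotZZ ab_0 mulr0 (scalar_mx_block 1) raddf0.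
rewrite mul_col_mx -!scalemxAl ag bg /rot2 mul_block_col !mul_scalar_mx.
by rewrite scalerBr scalerDr !scalerA mulNr scaleNr !(mulrC s).
Qed.

(** Serves a real pair [c = c^-1], where one eigenvector spans only a line; [hb] supplies the second
    inside the orthogonal complement. *)
Lemma plane_real n (g : 'M[R]_(1 + n)) p (a : 'rV[R]_(1 + n)) :
  g *m g^T = 1%:M -> a != 0 -> a *m g = p *: a ->
  (forall (g1 : 'M[R]_n) (P : 'M[R]_(1 + n)), g1 *m g1^T = 1%:M ->
     P *m P^T = 1%:M -> P *m g = block_mx p%:M 0 0 g1 *m P ->
     exists2 b : 'rV[R]_n, b != 0 & b *m g1 = p *: b) ->
  exists Q : 'M[R]_(1 + 1, 1 + n), Q *m Q^T = 1%:M /\ Q *m g = rot2 p 0 *m Q.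
Proof.
move=> gg a0 ag hb; have [s s0 sa] := normalize a0.
have QQ : s *: a *m (s *: a)^T = 1%:M by rewrite dot_mxE sa.
have Qg : s *: a *m g = p%:M *m (s *: a).
  by rewrite -scalemxAl ag mul_scalar_mx !scalerA mulrC.
have [W [g1 [PP g1g1 Pg]]] := @orthogonal_block 1 n g _ p%:M gg QQ Qg.
have Wg : W *m g = g1 *m W.
  move: Pg; rewrite mul_col_mx mul_block_col => /eq_col_mx[_ ->].
  by rewrite mul0mx add0r.
have [b b0 bg] := hb _ _ g1g1 PP Pg.
have [t t0 tb] := normalize b0.
move: PP; rewrite tr_col_mx mul_col_row (scalar_mx_block 1) => /eq_block_mx[_ aW Wa WW].
exists (col_mx (s *: a) (t *: b *m W) : 'M[R]_(1 + 1, _)); split.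
  rewrite tr_col_mx mul_col_row QQ trmx_mul mulmxA aW mul0mx -[_ *m W *m _]mulmxA Wa mulmx0.
  by rewrite mulmxA -[_ *m W *m _]mulmxA WW mulmx1 dot_mxE tb (scalar_mx_block 1).
rewrite mul_col_mx Qg /rot2 mul_block_col oppr0 !raddf0 !mul0mx addr0 add0r; congr col_mx.
by rewrite -mulmxA Wg mulmxA -!scalemxAl bg mul_scalar_mx -!scalemxAl !scalerA mulrC.
Qed.

End RealOrthogonal.

(** * Conjugating an element of SO(2m+1) into the maximal torus *)

Section NormalForm.
Variable R : realType.
Local Notation C := (cplx R).

HB.instance Definition _ := GRing.RMorphism.copy (@to_cplx R) (real_complex R).

Definition cRe (c : C) : R := complex.Re c.
Definition cIm (c : C) : R := complex.Im c.
Definition cI : C := ('i)%C.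

Lemma cplxE (c : C) : c = to_cplx (cRe c) + cI * to_cplx (cIm c).
Proof. exact: complexE. Qed.

Lemma cplx_eq (a b a' b' : R) :
  to_cplx a + cI * to_cplx b = to_cplx a' + cI * to_cplx b' -> a = a' /\ b = b'.
Proof.
by rewrite /to_cplx /cI; simpc => -[-> ->].
Qed.

Lemma cI2 : cI * cI = -1.
Proof. by rewrite -expr2; exact: sqr_i. Qed.

Lemma normc2 (c : C) : `|c| ^+ 2 = to_cplx (cRe c ^+ 2 + cIm c ^+ 2).
Proof. by rewrite /to_cplx -add_Re2_Im2. Qed.

Lemma norm1_ReIm (c : C) : `|c| = 1 <-> cRe c ^+ 2 + cIm c ^+ 2 = 1.
Proof.
split=> [c1|h].
  by have := normc2 c; rewrite c1 expr1n => /complexI.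
by apply/eqP; rewrite -(@pexpr_eq1 _ _ 2) // normc2 h.
Qed.

Lemma eigenpair_of_root N (g : 'M[R]_N) (c : C) :
  root (char_poly (map_mx (@to_cplx R) g)) c ->
  exists a b, eigenpair g (cRe c) (cIm c) a b /\ (a != 0) || (b != 0).
Proof.
rewrite -eigenvalue_root_char => /eigenvalueP[v vg v0].
pose a := map_mx cRe v; pose b := map_mx cIm v.
have vE : v = map_mx (@to_cplx R) a + cI *: map_mx (@to_cplx R) b.
  by apply/matrixP => i j; rewrite !mxE -cplxE.
exists a, b; split; last first.
  apply: contraNT v0; rewrite negb_or !negbK vE => /andP[/eqP-> /eqP->].
  by rewrite !map_mx0 scaler0 addr0.
have E : map_mx (@to_cplx R) (a *m g) + cI *: map_mx (@to_cplx R) (b *m g) =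
    map_mx (@to_cplx R) (cRe c *: a - cIm c *: b) +
    cI *: map_mx (@to_cplx R) (cIm c *: a + cRe c *: b).
  rewrite !map_mxM scalemxAl -mulmxDl -vE vg; apply/matrixP => i j.
  rewrite !mxE; set x := v i j.
  transitivity ((to_cplx (cRe c) + cI * to_cplx (cIm c)) *
                (to_cplx (cRe x) + cI * to_cplx (cIm x))); first by rewrite -!cplxE.
  rewrite !rmorphD !rmorphN !rmorphM /=.
  have := cI2; move: cI (to_cplx _) (to_cplx _) (to_cplx _) (to_cplx _).
  by move=> I p q r s I2; ring: I2.
have {}E i j := congr1 (fun M : 'M[C]_(1, N) => M i j) E.
by split; apply/matrixP => i j; have := E i j; rewrite !mxE => /cplx_eq[].
Qed.

Lemma char_poly_conj (F : fieldType) N (P A B : 'M[F]_N) :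
  P \in unitmx -> P *m A = B *m P -> char_poly A = char_poly B.
Proof.
rewrite unitmxE unitfE => P0 PA; pose PX := map_mx (@polyC F) P.
have d0 : \det PX != 0 by rewrite det_map_mx polyC_eq0.
apply: (mulfI d0); rewrite -det_mulmx mulrC -det_mulmx; congr (\det _).
rewrite /char_poly_mx mulmxBr mulmxBl -!map_mxM PA; congr (_ - _).
exact: scalar_mxC.
Qed.

Lemma char_poly_block (F : fieldType) n1 n2 (A : 'M[F]_n1) (B : 'M[F]_n2) :
  char_poly (block_mx A 0 0 B) = char_poly A * char_poly B.
Proof. by rewrite /char_poly char_block_diag_mx det_ublock. Qed.

Lemma orthogonal_unit N (P : 'M[R]_N) : P *m P^T = 1%:M ->
  map_mx (@to_cplx R) P \in unitmx.
Proof. by move=> PP; rewrite map_unitmx; have [] := mulmx1_unit PP. Qed.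

Lemma char_poly_orthogonal N (P g h : 'M[R]_N) : P *m P^T = 1%:M ->
  P *m g = h *m P ->
  char_poly (map_mx (@to_cplx R) g) = char_poly (map_mx (@to_cplx R) h).
Proof.
move=> PP Pg; apply: (char_poly_conj (orthogonal_unit PP)).
by rewrite -!map_mxM Pg.
Qed.

Lemma char_poly_map_block n1 n2 (A : 'M[R]_n1) (B : 'M[R]_n2) :
  char_poly (map_mx (@to_cplx R) (block_mx A 0 0 B)) =
  char_poly (map_mx (@to_cplx R) A) * char_poly (map_mx (@to_cplx R) B).
Proof. by rewrite map_block_mx !map_mx0 char_poly_block. Qed.

Definition rotation (c : C) : 'M[R]_(1 + 1) := rot2 (cRe c) (cIm c).

Lemma det_mx2 (F : comNzRingType) (A : 'M[F]_(1 + 1)) :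
  \det A = A 0 0 * A 1 1 - A 0 1 * A 1 0.
Proof.
rewrite (expand_det_row _ 0) !big_ord_recl big_ord0 /cofactor !det_mx11 !mxE /=.
rewrite (_ : lift 0 0 = 1 :> 'I_2); last exact: val_inj.
rewrite (_ : lift 1 0 = 0 :> 'I_2); last exact: val_inj.
by rewrite /bump /= !addn0 expr0 expr1 mul1r mulN1r mulrN addr0.
Qed.

Lemma det_block2 (F : comNzRingType) (a b c d : F) :
  \det (block_mx a%:M b%:M c%:M d%:M : 'M[F]_(1 + 1)) = a * d - b * c.
Proof.
rewrite det_mx2 (_ : 0 = @lshift 1 1 0 :> 'I_(1 + 1)); last exact: val_inj.
rewrite (_ : 1 = @rshift 1 1 0 :> 'I_(1 + 1)); last exact: val_inj.
by rewrite block_mxEul block_mxEur block_mxEdl block_mxEdr !mxE.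
Qed.

Lemma det_rotation (c : C) : `|c| = 1 -> \det (rotation c) = 1.
Proof. by move=> /norm1_ReIm <-; rewrite det_block2; ring. Qed.

Lemma rotation_orth (c : C) : `|c| = 1 -> rotation c *m (rotation c)^T = 1%:M.
Proof.
move=> /norm1_ReIm c1; rewrite /rotation /rot2 tr_block_mx mulmx_block !tr_scalar_mx.
rewrite -!scalar_mxM -!raddfD [RHS]scalar_mx_block -c1.
by congr block_mx; apply/matrixP => i j; rewrite !mxE !ord1 eqxx ?mulr1n; ring.
Qed.

Lemma norm1_inv (c : C) : `|c| = 1 -> c^-1 = to_cplx (cRe c) - cI * to_cplx (cIm c).
Proof.
move=> c1; have c0 : c != 0 by rewrite -normr_eq0 c1 oner_eq0.
apply: (mulfI c0); rewrite mulfV // {1}(cplxE c).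
have /norm1_ReIm/(congr1 (@to_cplx R)) := c1; rewrite rmorph1 rmorphD !rmorphXn /= => <-.
have := cI2; move: cI (to_cplx (cRe c)) (to_cplx (cIm c)) => I p q I2.
transitivity (p ^+ 2 - (I * I) * q ^+ 2); last by ring.
by rewrite I2; ring.
Qed.

Lemma char_poly_rotation (c : C) : `|c| = 1 ->
  char_poly (map_mx (@to_cplx R) (rotation c)) = ('X - c%:P) * ('X - c^-1%:P).
Proof.
move=> c1; have c0 : c != 0 by rewrite -normr_eq0 c1 oner_eq0.
have -> : ('X - c%:P) * ('X - c^-1%:P) = 'X ^+ 2 - (c + c^-1)%:P * 'X + (c * c^-1)%:P.
  by rewrite polyCD polyCM; ring.
have -> : c + c^-1 = to_cplx (cRe c) + to_cplx (cRe c).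
  rewrite norm1_inv //; have := cplxE c.
  by move: (to_cplx (cRe c)) (to_cplx (cIm c)) => p q {1}->; ring.
have /norm1_ReIm/(congr1 (@to_cplx R)) := c1.
rewrite mulfV // rmorph1 rmorphD !rmorphXn /= => <-.
rewrite /char_poly /char_poly_mx map_block_mx !map_scalar_mx scalar_mx_block.
rewrite map_block_mx !map_scalar_mx opp_block_mx add_block_mx !add0r.
rewrite -!(raddfN (@scalar_mx {poly C} 1)) -!(raddfD (@scalar_mx {poly C} 1)) det_block2.
rewrite (rmorphN (@to_cplx R)) /=.
by move: (to_cplx (cRe c)) (to_cplx (cIm c)) => p q; rewrite !(polyCN, polyCD, polyC_exp); ring.
Qed.

(** An infinite sequence of eigenvalues lets the recursion simply shift it; the last diagonal entry
    is the fixed eigenvalue 1. *)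
Fixpoint torus_mx m (x : nat -> C) : 'M[R]_(m.*2.+1) :=
  if m is m'.+1 then block_mx (rotation (x 0%N)) 0 0 (torus_mx m' (x \o succn)) else 1%:M.

Lemma block_orth n1 n2 (A : 'M[R]_n1) (B : 'M[R]_n2) :
  A *m A^T = 1%:M -> B *m B^T = 1%:M ->
  block_mx A 0 0 B *m (block_mx A 0 0 B)^T = 1%:M.
Proof.
move=> AA BB; rewrite tr_block_mx mulmx_block !trmx0 !mulmx0 !mul0mx AA BB.
by rewrite !addr0 !add0r -scalar_mx_block.
Qed.

Lemma block_intertwine n1 n2 (A : 'M[R]_n1) (P B D : 'M[R]_n2) : P *m B = D *m P ->
  block_mx 1%:M 0 0 P *m block_mx A 0 0 B = block_mx A 0 0 D *m block_mx 1%:M 0 0 P.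
Proof.
by move=> PB; rewrite !mulmx_block PB !(mul1mx, mul0mx, mulmx0, mulmx1, addr0, add0r).
Qed.

Lemma torus_mx_orth m (x : nat -> C) : (forall l, `|x l| = 1) ->
  torus_mx m x *m (torus_mx m x)^T = 1%:M.
Proof.
elim: m x => [|m IH] x x1 /=; first by rewrite trmx1 mulmx1.
have := IH _ (fun l => x1 l.+1); move: (torus_mx m _) => T TT.
exact: block_orth (rotation_orth _) TT.
Qed.

Lemma det_torus_mx m (x : nat -> C) : (forall l, `|x l| = 1) -> \det (torus_mx m x) = 1.
Proof.
elim: m x => [|m IH] x x1 /=; first by rewrite det1.
by rewrite (det_ublock (rotation (x 0%N))) det_rotation // IH ?mul1r // => l; apply: x1.
Qed.

Lemma char_poly_torus_mx m (x : nat -> C) : (forall l, `|x l| = 1) ->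
  char_poly (map_mx (@to_cplx R) (torus_mx m x)) =
  (\prod_(i < m) (('X - (x i)%:P) * ('X - (x i)^-1%:P))) * ('X - 1%:P).
Proof.
elim: m x => [|m IH] x x1 /=.
  rewrite big_ord0 mul1r map_mx1 /char_poly /char_poly_mx map_mx1.
  by rewrite -raddfB det_scalar1.
rewrite (char_poly_map_block (rotation (x 0%N))) IH => [|l]; last exact: x1.
by rewrite char_poly_rotation // big_ord_recl /= mulrA.
Qed.

Lemma real_eigenvector N (g : 'M[R]_N) (c : C) (p : R) :
  c = to_cplx p -> root (char_poly (map_mx (@to_cplx R) g)) c ->
  exists2 b : 'rV[R]_N, b != 0 & b *m g = p *: b.
Proof.
move=> -> /eigenpair_of_root[a [b [[ag bg] /orP[a0|b0]]]].
  by exists a => //; rewrite ag /cIm /= scale0r subr0.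
by exists b => //; rewrite bg /cIm /= scale0r add0r.
Qed.

Lemma invariant_plane n (g : 'M[R]_(1 + 1 + n)) (c : C) (r : {poly C}) :
  g *m g^T = 1%:M ->
  char_poly (map_mx (@to_cplx R) g) = ('X - c%:P) * ('X - c^-1%:P) * r ->
  exists Q : 'M[R]_(1 + 1, 1 + 1 + n), Q *m Q^T = 1%:M /\ Q *m g = rotation c *m Q.
Proof.
move=> gg gE; have c_root : root (char_poly (map_mx (@to_cplx R) g)) c.
  by rewrite gE !rootM root_XsubC eqxx.
have [a [b [gab ab0]]] := eigenpair_of_root c_root.
have pq := eigenpair_norm gg gab ab0.
have [q0|q0] := eqVneq (cIm c) 0; last exact: plane_nonreal gab ab0 q0.
have cE : c = to_cplx (cRe c) by rewrite [LHS]cplxE q0 rmorph0 mulr0 addr0.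
(* A real [c] of modulus 1 is its own inverse, hence a double root. *)
have cV : c^-1 = c by rewrite norm1_inv ?q0 ?rmorph0 ?mulr0 ?subr0 //; apply/norm1_ReIm.
have [d d0 dg] := real_eigenvector cE c_root.
rewrite /rotation q0; apply: (plane_real (n := 1 + n) gg d0 dg) => g1 P g1g1 PP Pg.
(* The line already split off accounts for one factor [X - c]; the other is left for [g1]. *)
apply: (real_eigenvector cE); have := char_poly_orthogonal PP Pg.
rewrite char_poly_map_block gE cV -mulrA map_scalar_mx /= -cE.
have -> : char_poly (c%:M : 'M[C]_1) = 'X - c%:P.
  by rewrite /char_poly /char_poly_mx map_scalar_mx -raddfB det_scalar1.
by move=> /mulfI <-; rewrite ?polyXsubC_eq0 // rootM root_XsubC eqxx.
Qed.

Lemma eigen_norm1 N (g : 'M[R]_N) (c : C) : g *m g^T = 1%:M ->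
  root (char_poly (map_mx (@to_cplx R) g)) c -> `|c| = 1.
Proof.
move=> gg /eigenpair_of_root[a [b [gab ab0]]].
exact/norm1_ReIm/(eigenpair_norm gg gab ab0).
Qed.

(** Induction on [m], splitting off the plane of [x 0]. The given order, and the choice within each
    pair, are kept, so that perturbing [x] perturbs the normal form. *)
Lemma normal_form m (g : 'M[R]_(m.*2.+1)) (x : nat -> C) : g *m g^T = 1%:M ->
  char_poly (map_mx (@to_cplx R) g) =
    (\prod_(i < m) (('X - (x i)%:P) * ('X - (x i)^-1%:P))) * ('X - 1%:P) ->
  exists2 P : 'M[R]_(m.*2.+1), P *m P^T = 1%:M & P *m g = torus_mx m x *m P.
Proof.
elim: m g x => [|m IH] g x gg gE.
  exists 1%:M; rewrite ?trmx1 ?mulmx1 ?mul1mx //=.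
  rewrite [g]mx11_scalar; congr (_%:M).
  move: gE; rewrite big_ord0 mul1r [g]mx11_scalar map_scalar_mx.
  rewrite /char_poly /char_poly_mx map_scalar_mx -raddfB det_scalar1 /=.
  by move=> /addrI/oppr_inj/polyC_inj; rewrite mxE => /complexI.
rewrite big_ord_recl -mulrA in gE.
have [Q [QQ Qg]] := @invariant_plane m.*2.+1 g _ _ gg gE.
have c1 : `|x 0%N| = 1.
  by apply: (eigen_norm1 gg); rewrite gE !rootM root_XsubC eqxx.
have [W [g' [PP gg' Pg]]] := @orthogonal_block _ (1 + 1)%N m.*2.+1 g Q _ gg QQ Qg.
have [|P' PP' Pg'] := IH g' (x \o succn) gg'.
  have := char_poly_orthogonal PP Pg; rewrite char_poly_map_block char_poly_rotation // gE.
  by move=> /mulfI <- //; rewrite mulf_neq0 ?polyXsubC_eq0.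
pose B : 'M[R]_(1 + 1 + m.*2.+1) := block_mx 1%:M 0 0 P'.
have BB : B *m B^T = 1%:M by apply: block_orth; rewrite // trmx1 mulmx1.
exists (B *m col_mx Q W).
  by rewrite trmx_mul mulmxA -(mulmxA B) PP mulmx1.
rewrite /= -[LHS]mulmxA Pg !mulmxA; congr (_ *m _).
exact: (@block_intertwine _ _ (rotation (x 0%N)) _ _ _ Pg').
Qed.
End NormalForm.

(** * Limits of matrices, determinants and divided differences *)

Section EntrywiseLimits.
Variables (K : numFieldType) (T : Type) (F : set_system T).
Context {FF : Filter F}.

Lemma cvg_bigsum I (r : seq I) (P : pred I) (f : I -> T -> K) (a : I -> K) :
  (forall i, P i -> f i x @[x --> F] --> a i) ->
  \sum_(i <- r | P i) f i x @[x --> F] --> \sum_(i <- r | P i) a i.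
Proof. exact: (cvg_big add_continuous). Qed.

Lemma cvg_bigprod I (r : seq I) (P : pred I) (f : I -> T -> K) (a : I -> K) :
  (forall i, P i -> f i x @[x --> F] --> a i) ->
  \prod_(i <- r | P i) f i x @[x --> F] --> \prod_(i <- r | P i) a i.
Proof. exact: (cvg_big mul_continuous). Qed.

Lemma cvg_det n (f : T -> 'M[K]_n) (a : 'M[K]_n) :
  (forall i j, f x i j @[x --> F] --> a i j) -> \det (f x) @[x --> F] --> \det a.
Proof.
move=> fa; apply: cvg_bigsum => s _; apply: cvgM; first exact: cvg_cst.
by apply: cvg_bigprod => i _; exact: fa.
Qed.

Lemma cvg_mulmx m n p (f : T -> 'M[K]_(m, n)) (g : T -> 'M[K]_(n, p))
    (a : 'M[K]_(m, n)) (b : 'M[K]_(n, p)) :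
  (forall i j, f x i j @[x --> F] --> a i j) ->
  (forall i j, g x i j @[x --> F] --> b i j) ->
  forall i j, (f x *m g x) i j @[x --> F] --> (a *m b) i j.
Proof.
move=> fa gb i j; rewrite mxE; under eq_fun do rewrite mxE.
by apply: cvg_bigsum => k _; apply: cvgM; [exact: fa | exact: gb].
Qed.

Lemma cvg_entrywise m n (f : T -> 'M[K]_(m, n)) (a : 'M[K]_(m, n)) :
  (forall i j, f x i j @[x --> F] --> a i j) -> f x @[x --> F] --> a.
Proof.
move=> fa; apply/cvg_ballP => e e0.
suff : \forall x \near F, forall i j, ball (a i j) e (f x i j).
  by apply: filterS => x fx; split.
apply: filter_forall => i; apply: filter_forall => j.
by move/cvg_ballP: (fa i j); apply.
Qed.

Lemma cvg_entry m n (f : T -> 'M[K]_(m, n)) (a : 'M[K]_(m, n)) i j :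
  f x @[x --> F] --> a -> f x i j @[x --> F] --> a i j.
Proof. by move=> fa; apply: (continuous_cvg _ (@coord_continuous K m n i j a) fa). Qed.

Lemma cvg_geo (a : T -> K) (a0 : K) (f : T -> nat -> K) (f0 : nat -> K) :
  a x @[x --> F] --> a0 -> (forall k, f x k @[x --> F] --> f0 k) ->
  forall k, geo (a x) (f x) k @[x --> F] --> geo a0 f0 k.
Proof.
move=> aa ff; elim=> [|k IH] /=; first exact: ff.
by apply: cvgD; [exact: cvgM | exact: ff].
Qed.

(** Only inverses of single nodes occur in the recursion, so the limiting nodes may coincide. *)
Lemma cvg_ddiff (xs : T -> nat -> K) (xs0 : nat -> K) : (forall l, xs0 l != 0) ->
  (forall l, xs x l @[x --> F] --> xs0 l) ->
  forall l k, ddiff (xs x) l k @[x --> F] --> ddiff xs0 l k.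
Proof.
move=> x0 xx; have quad_cvg l (f : T -> nat -> K) (f0 : nat -> K) :
    (forall k, f x k @[x --> F] --> f0 k) ->
    forall k, quad (xs x l) (f x) k @[x --> F] --> quad (xs0 l) f0 k.
  by move=> ff; apply: cvg_geo; [exact: cvgV | apply: cvg_geo].
elim=> [|l IH] k; rewrite ddiffE; under eq_fun do rewrite ddiffE.
  by apply: quad_cvg => j; exact: cvg_cst.
by apply: quad_cvg => -[|j] /=; [exact: cvg_cst | exact: IH].
Qed.

Lemma cvg_det_ddiff m (xs : T -> nat -> K) (xs0 : nat -> K) (k : 'I_m -> nat) :
  (forall l, xs0 l != 0) -> (forall l, xs x l @[x --> F] --> xs0 l) ->
  \det (ddiff_mx m (xs x) k) @[x --> F] --> \det (ddiff_mx m xs0 k).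
Proof.
move=> x0 xx; apply: cvg_det => i j; rewrite mxE; under eq_fun do rewrite mxE.
exact: cvg_ddiff.
Qed.

End EntrywiseLimits.

(** * Complex limits through real and imaginary parts *)

Section ComplexLimits.
Variable R : realType.
Local Notation C := (cplx R).
Variables (T : Type) (F : set_system T).
Context {FF : Filter F}.

Lemma norm_to_cplx (a : R) : `|to_cplx a| = to_cplx `|a|.
Proof. by rewrite /to_cplx normc_def /= expr0n /= addr0 sqrtr_sqr. Qed.

Lemma to_cplx_lt (a b : R) : (to_cplx a < to_cplx b) = (a < b).
Proof. exact: ltcR. Qed.

Lemma to_cplx_le (a b : R) : (to_cplx a <= to_cplx b) = (a <= b).
Proof. exact: lecR. Qed.

Lemma pos_cplx (e : C) : 0 < e -> exists2 r : R, 0 < r & e = to_cplx r.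
Proof.
rewrite ltcE /= => /andP[/eqP i0 r0]; exists (cRe e) => //.
by rewrite [LHS]cplxE /cIm i0 rmorph0 mulr0 addr0.
Qed.

Lemma cvg_to_cplx (f : T -> R) (a : R) :
  f x @[x --> F] --> a -> to_cplx (f x) @[x --> F] --> to_cplx a.
Proof.
move=> /cvgrPdist_lt fa; apply/cvgrPdist_lt => e /pos_cplx[r r0 ->].
apply: filterS (fa r r0) => x.
by rewrite -rmorphB norm_to_cplx to_cplx_lt.
Qed.

Lemma cRe_le (c : C) : `|cRe c| <= cRe `|c|.
Proof. by have := normc_ge_Re c; rewrite lecE => /andP[]. Qed.

Lemma cvg_cRe (f : T -> C) (a : C) : f x @[x --> F] --> a -> cRe (f x) @[x --> F] --> cRe a.
Proof.
move=> /cvgrPdist_lt fa; apply/cvgrPdist_lt => e e0.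
have e0' : 0 < to_cplx e by rewrite -(rmorph0 (@to_cplx R)) to_cplx_lt.
apply: filterS (fa _ e0') => x; rewrite ltcE => /andP[_ h].
by apply: le_lt_trans h; rewrite /cRe -raddfB; exact: cRe_le.
Qed.

Lemma cvg_cIm (f : T -> C) (a : C) : f x @[x --> F] --> a -> cIm (f x) @[x --> F] --> cIm a.
Proof.
move=> fa; have E (c : C) : cIm c = cRe (- cI R * c).
  by rewrite /cRe /cIm /cI; case: c => p q; simpc.
rewrite E; under eq_fun do rewrite E.
by apply: cvg_cRe; apply: (@cvgM C); [exact: cvg_cst | exact: fa].
Qed.

Lemma cvg_torus_mx m (xs : T -> nat -> C) (xs0 : nat -> C) :
  (forall l, xs x l @[x --> F] --> xs0 l) ->
  forall i j, torus_mx m (xs x) i j @[x --> F] --> torus_mx m xs0 i j.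
Proof.
elim: m xs xs0 => [|m IH] xs xs0 xx i j; first exact: cvg_cst.
suff : forall i j : 'I_(1 + 1 + m.*2.+1),
  (block_mx (rotation (xs x 0%N)) 0 0 (torus_mx m (xs x \o succn))
     : 'M[R]_(1 + 1 + m.*2.+1)) i j @[x --> F] -->
  (block_mx (rotation (xs0 0%N)) 0 0 (torus_mx m (xs0 \o succn))
     : 'M[R]_(1 + 1 + m.*2.+1)) i j by apply.
have rc : forall i j, rotation (xs x 0%N) i j @[x --> F] --> rotation (xs0 0%N) i j.
  have re := cvg_cRe (xx 0%N); have im := cvg_cIm (xx 0%N).
  move=> {}i {}j; rewrite !mxE; under eq_fun do rewrite !mxE.
  case: (fintype.split i) => i'; rewrite !mxE; under eq_fun do rewrite !mxE.
    case: (fintype.split j) => j'; rewrite !mxE; under eq_fun do rewrite !mxE; rewrite !ord1 eqxx mulr1n;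
      under eq_fun do rewrite mulr1n; [exact: re | exact: cvgN].
  by case: (fintype.split j) => j'; rewrite !mxE; under eq_fun do rewrite !mxE; rewrite !ord1 eqxx mulr1n;
      under eq_fun do rewrite mulr1n.
move=> {}i {}j; rewrite !mxE; under eq_fun do rewrite !mxE.
case: (fintype.split i) => i'; rewrite !mxE; under eq_fun do rewrite !mxE.
  by case: (fintype.split j) => j'; [exact: rc | rewrite mxE; exact: cvg_cst].
case: (fintype.split j) => j'; first by rewrite mxE; exact: cvg_cst.
by apply: IH => l; exact: xx.
Qed.

End ComplexLimits.

(** * Values of the characters at all points, regular or singular *)

Section CharacterValue.
Variables (R : realType) (m : nat).
Local Notation C := (cplx R).
Implicit Types (x : 'rV[C]_m) (k : 'I_m -> nat).

(** The default 1 lies on the unit circle, so a torus point gives a sequence of modulus 1 at every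
    index. *)
Definition entry x (l : nat) : C := oapp (x 0) 1 (insub l).

Lemma entry_ord x (i : 'I_m) : entry x i = x 0 i.
Proof. by rewrite /entry valK. Qed.

Lemma entry_norm1 x : torus R m x -> forall l, `|entry x l| = 1.
Proof. by move=> tx l; rewrite /entry; case: insub => [i|] /=; [exact: tx | rewrite normr1]. Qed.

Lemma norm1_neq0 (c : C) : `|c| = 1 -> c != 0.
Proof. by move=> c1; rewrite -normr_eq0 c1 oner_eq0. Qed.

Lemma entry_neq0 x : torus R m x -> forall l, entry x l != 0.
Proof. by move=> tx l; apply/norm1_neq0/entry_norm1. Qed.

(** Only the last factor depends on [k]; the first two cancel in Weyl's quotient. *)
Lemma half_det_ddiff k x : torus R m x ->
  half_det k x = (\prod_i (sqrtC (x 0 i) - (sqrtC (x 0 i))^-1)) *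
    \det (newton_mx m (entry x)) * \det (ddiff_mx m (entry x) k).
Proof.
move=> tx; rewrite -mulrA -det_mulmx -odd_char_mxE; last exact: entry_neq0.
pose d : 'rV[C]_m := \row_i (sqrtC (x 0 i) - (sqrtC (x 0 i))^-1).
rewrite (_ : \prod_i _ = \det (diag_mx d)); last first.
  by rewrite det_diag; apply: eq_bigr => i _; rewrite mxE.
rewrite -det_mulmx; congr (\det _); rewrite mul_diag_mx; apply/matrixP => i j.
rewrite !mxE half_power_odd_char ?sqrtCK ?entry_ord //.
by rewrite sqrtC_eq0 norm1_neq0.
Qed.

Definition label (l : mpartition m) (j : 'I_m) : nat := (part l j + (m - j.+1))%N.

(* The Weyl quotient after cancelling the Newton determinant from numerator and
   denominator: it is defined and continuous on the whole torus. *)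
Definition char_poly_value (l : mpartition m) x : C :=
  (-1) ^+ (perm (@rev_ord_inj m)) * \det (ddiff_mx m (entry x) (label l)).

Lemma weyl_quotient (l : mpartition m) x : torus R m x -> weyl_den x != 0 ->
  weyl_num l x / weyl_den x = char_poly_value l x.
Proof.
move=> tx; rewrite /weyl_den /weyl_num !half_det_ddiff // det_ddiff_mx_rev.
set d := \prod_i _; set n := \det _.
rewrite !mulf_eq0 !negb_or => /andP[/andP[d0 n0] _]; rewrite /char_poly_value.
set s := (-1) ^+ _; have s2 : s * s = 1 by rewrite -expr2 sqrr_sign.
have s0 : s != 0 by rewrite signr_eq0.
have sV : s^-1 = s by apply: (mulfI s0); rewrite s2 mulfV.
by rewrite /label -[X in _ = X * _]sV; field; rewrite ?d0 ?n0 ?s0.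
Qed.

Lemma recip_sum_eq (F : fieldType) (x y : F) : x != 0 -> y != 0 ->
  recip_sum x = recip_sum y -> x = y \/ x * y = 1.
Proof.
move=> x0 y0 E; have : (x - y) * (x * y - 1) = 0.
  have -> : (x - y) * (x * y - 1) = x * y * (recip_sum x - recip_sum y).
    by rewrite /recip_sum; field; rewrite x0 y0.
  by rewrite E subrr mulr0.
by move/eqP; rewrite mulf_eq0 !subr_eq0 => /orP[/eqP|/eqP]; [left | right].
Qed.

Lemma weyl_den_neq0 x : torus R m x -> (forall i, x 0 i != 1) ->
  (forall i j : 'I_m, (j < i)%N -> x 0 i != x 0 j /\ x 0 i * x 0 j != 1) ->
  weyl_den x != 0.
Proof.
move=> tx x1 xij; rewrite /weyl_den half_det_ddiff // det_ddiff_mx_rev det_newton_mx.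
rewrite !mulf_neq0 ?signr_eq0 //; apply/prodf_neq0 => i _.
  have s0 : sqrtC (x 0 i) != 0 by rewrite sqrtC_eq0 norm1_neq0.
  apply: contra_neq (x1 i) => /eqP; rewrite subr_eq0 => /eqP s1.
  by rewrite -(sqrtCK (x 0 i)) expr2 {1}s1 mulVf.
apply/prodf_neq0 => j _; rewrite subr_eq0; apply/eqP.
pose j' : 'I_m := Ordinal (ltn_trans (ltn_ord j) (ltn_ord i)).
have [ij1 ij2] := xij i j' (ltn_ord j).
rewrite entry_ord -[nat_of_ord j]/(nat_of_ord j') entry_ord.
by move/recip_sum_eq => []; [exact: norm1_neq0 | exact: norm1_neq0 | exact/eqP | exact/eqP].
Qed.

(** The Cayley transform: a rational parametrization of the unit circle without -1, sending 0 to 1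
    and negation to inversion. *)
Definition cayley (s : R) : C := (1 + cI R * to_cplx s) / (1 - cI R * to_cplx s).

Lemma cayley_num (s : R) : 1 + cI R * to_cplx s != 0.
Proof.
apply/eqP => E; have [/eqP] : 1 = 0 :> R /\ s = 0.
  by apply: cplx_eq; rewrite rmorph1 rmorph0 mulr0 addr0.
by rewrite oner_eq0.
Qed.

Lemma cayley_den (s : R) : 1 - cI R * to_cplx s != 0.
Proof. by have := cayley_num (- s); rewrite rmorphN mulrN. Qed.

Lemma cayley_norm1 s : `|cayley s| = 1.
Proof.
rewrite /cayley normf_div; apply: (canLR (mulfK _)); rewrite ?normr_eq0 ?cayley_den //.
rewrite mul1r; apply/eqP; rewrite -(@eqrXn2 _ 2) // !normc2; apply/eqP; congr to_cplx.
by rewrite /cRe /cIm /cI /to_cplx; simpc => /=; ring.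
Qed.

Lemma cayley_mul_eq1 a b : cayley a * cayley b = 1 -> a + b = 0.
Proof.
move=> ab; have E : (1 + cI R * to_cplx a) * (1 + cI R * to_cplx b) =
    (1 - cI R * to_cplx a) * (1 - cI R * to_cplx b).
  move: ab; rewrite /cayley mulf_div => /divr1_eq -> //.
have : cI R * to_cplx (a + b) = 0.
  have : 2 * (cI R * to_cplx (a + b)) = 0.
    rewrite rmorphD /= -(subrr ((1 - cI R * to_cplx a) * (1 - cI R * to_cplx b))) -{1}E.
    ring.
  by move/eqP; rewrite mulf_eq0 pnatr_eq0 => /eqP.
move=> E0; have [] : 0 = 0 :> R /\ a + b = 0 by apply: cplx_eq; rewrite rmorph0 mulr0 E0.
by [].
Qed.

Lemma cayleyV a : (cayley a)^-1 = cayley (- a).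
Proof. by rewrite /cayley invf_div rmorphN mulrN opprK. Qed.

Lemma cvg_cayley (u : nat -> R) : u n @[n --> \oo] --> 0 ->
  cayley (u n) @[n --> \oo] --> (1 : C).
Proof.
move=> /cvg_to_cplx; rewrite rmorph0 => u0.
have iu : cI R * to_cplx (u n) @[n --> \oo] --> cI R * (0 : C).
  by apply: (@cvgM C); [exact: cvg_cst | exact: u0].
rewrite mulr0 in iu.
have iD : 1 + cI R * to_cplx (u n) @[n --> \oo] --> 1 + (0 : C).
  by apply: (@cvgD C C^o); [exact: cvg_cst | exact: iu].
have iB : 1 - cI R * to_cplx (u n) @[n --> \oo] --> 1 - (0 : C).
  by apply: (@cvgD C C^o); [exact: cvg_cst | apply: (@cvgN C C^o); exact: iu].
rewrite addr0 in iD; rewrite subr0 in iB.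
suff : cayley (u n) @[n --> \oo] --> 1 / (1 : C) by rewrite divr1.
by apply: (@cvgM C); [exact: iD | apply: (@cvgV C); [exact: oner_neq0 | exact: iB]].
Qed.

Definition harmonic_cayley (a : R) (n : nat) : C := cayley (a * n.+1%:R^-1).

Lemma cvg_harmonic_cayley a : harmonic_cayley a n @[n --> \oo] --> (1 : C).
Proof.
suff : a * n.+1%:R^-1 @[n --> \oo] --> a * 0 by rewrite mulr0; exact: cvg_cayley.
by apply: (@cvgM R); [exact: cvg_cst | exact: cvg_harmonic].
Qed.

(** If [c != 1], the product tends to [c] and so eventually avoids 1; if [c = 1], equality would
    force [a + b = 0]. *)
Lemma harmonic_cayley_avoid a b (c : C) : a + b != 0 ->
  \forall n \near \oo, c * harmonic_cayley a n * harmonic_cayley b n != 1.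
Proof.
move=> ab; have [->|c1] := eqVneq c 1.
  apply: nearW => n; apply: contra_neq ab; rewrite mul1r => /cayley_mul_eq1.
  by rewrite -mulrDl => /eqP; rewrite mulf_eq0 invr_eq0 pnatr_eq0 orbF => /eqP.
have : c * harmonic_cayley a n * harmonic_cayley b n - 1 @[n --> \oo] --> c * 1 * 1 - 1.
  apply: (@cvgD C C^o); last exact: cvg_cst.
  apply: (@cvgM C); last exact: cvg_harmonic_cayley.
  by apply: (@cvgM C); [exact: cvg_cst | exact: cvg_harmonic_cayley].
rewrite !mulr1.
move/cvgr_neq0; rewrite subr_eq0 => /(_ c1); apply: filterS => n.
by rewrite subr_eq0.
Qed.

(* The distinct speeds [i + 1] separate all coordinates from each other, from
   each other's inverses and from 1, as soon as n is large. *)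
Definition perturb x (n : nat) : 'rV[C]_m :=
  \row_i (x 0 i * harmonic_cayley i.+1%:R n).

Lemma torus_perturb x n : torus R m x -> torus R m (perturb x n).
Proof. by move=> tx i; rewrite mxE normrM tx mul1r cayley_norm1. Qed.

Lemma cvg_entry_perturb x l : entry (perturb x n) l @[n --> \oo] --> entry x l.
Proof.
rewrite /entry; case: insub => [i|] /=; last exact: (@cvg_cst C).
under eq_fun do rewrite mxE.
suff : x 0 i * harmonic_cayley i.+1%:R n @[n --> \oo] --> x 0 i * 1 by rewrite mulr1.
by apply: (@cvgM C); [exact: cvg_cst | exact: cvg_harmonic_cayley].
Qed.

Lemma perturb_regular x : torus R m x -> \forall n \near \oo, weyl_den (perturb x n) != 0.
Proof.
move=> tx; have n0 i := norm1_neq0 (tx i).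
have h1 : \forall n \near \oo, forall i, perturb x n 0 i != 1.
  apply: filter_forall => i.
  (* Speed 0 makes the second factor constantly 1. *)
  have := @harmonic_cayley_avoid i.+1%:R 0 (x 0 i); rewrite addr0 pnatr_eq0 => /(_ isT).
  apply: filterS => n; rewrite mxE {2}/harmonic_cayley mul0r /cayley rmorph0 mulr0.
  by rewrite subr0 addr0 divr1 mulr1.
have h2 : \forall n \near \oo, forall i j : 'I_m, (j < i)%N ->
    perturb x n 0 i != perturb x n 0 j /\ perturb x n 0 i * perturb x n 0 j != 1.
  apply: filter_forall => i; apply: filter_forall => j.
  have [ji|ji] := ltnP j i; last by apply: nearW.
  (* [d1] keeps the quotient of the two coordinates away from 1, a negative speed giving the
     inverse; [d2] does so for their product. *)
  have d1 : i.+1%:R + - j.+1%:R != 0 :> R.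
    by rewrite subr_eq0 eqr_nat eqSS gtn_eqF.
  have d2 : i.+1%:R + j.+1%:R != 0 :> R by rewrite -natrD pnatr_eq0.
  apply: filterS2 (harmonic_cayley_avoid (x 0 i / x 0 j) d1)
    (harmonic_cayley_avoid (x 0 i * x 0 j) d2) => n; rewrite !mxE => e1 e2 _; split.
    apply: contra_neq e1; rewrite /harmonic_cayley mulNr -cayleyV.
    have q0 := norm1_neq0 (cayley_norm1 (j.+1%:R * n.+1%:R^-1)).
    move=> E; transitivity ((x 0 i * cayley (i.+1%:R * n.+1%:R^-1)) /
      (x 0 j * cayley (j.+1%:R * n.+1%:R^-1))); last by rewrite E divff // mulf_neq0.
    by rewrite [in RHS]invfM [RHS]mulrACA mulrA.
  by rewrite mulrACA mulrA.
by apply: filterS2 h1 h2 => n h1 h2; apply: weyl_den_neq0 => //; exact: torus_perturb.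
Qed.

Lemma so_eigenvalues_torus (g : 'M[R]_(m.*2.+1)) x :
  SO R _ g -> so_eigenvalues g x -> torus R m x.
Proof.
move=> [gg _] gx i; apply: (eigen_norm1 gg); rewrite gx rootM; apply/orP; left.
by rewrite (bigD1 i) //= !rootM root_XsubC eqxx.
Qed.

Lemma cvg_char_poly_value (T : Type) (F : set_system T) {FF : Filter F}
    (l : mpartition m) (xs : T -> 'rV[C]_m) x : torus R m x ->
  (forall l, entry (xs t) l @[t --> F] --> entry x l) ->
  char_poly_value l (xs t) @[t --> F] --> char_poly_value l x.
Proof.
move=> tx xx; apply: (@cvgM C); first exact: cvg_cst.
by apply: (@cvg_det_ddiff C) => //; exact: entry_neq0.
Qed.

(* Weyl's formula gives chi only where its denominator does not vanish. Elsewhere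
   g is conjugated to the torus, approximated by regular torus elements, and the
   continuity of rho is used. *)
Lemma so_character_value (l : mpartition m) (chi : 'M[R]_(m.*2.+1) -> C)
    (g : 'M[R]_(m.*2.+1)) x :
  so_character l chi -> SO R _ g -> so_eigenvalues g x -> chi g = char_poly_value l x.
Proof.
move=> [[d [rho [[_ _ rho_cont] _ chi_tr]]] chi_weyl] gSO gx.
have tx := so_eigenvalues_torus gSO gx; have [gg _] := gSO.
have [|P PP Pg] := @normal_form _ m g (entry x) gg.
  by rewrite gx; congr (_ * _); apply: eq_bigr => i _; rewrite entry_ord.
have PP' : P^T *m P = 1%:M by exact: mulmx1C.
pose T n := torus_mx m (entry (perturb x n)).
pose gs n := P^T *m T n *m P.
have tn n := torus_perturb n tx; have en n := entry_norm1 (tn n).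
have Pgs n : P *m gs n = T n *m P by rewrite /gs !mulmxA PP mul1mx.
have gsSO n : SO R _ (gs n).
  split; last first.
    (* [P] may have determinant -1; conjugation by it still preserves the determinant. *)
    rewrite /gs !det_mulmx det_torus_mx // mulr1 -det_mulmx PP' det1 //.
  rewrite /gs !trmx_mul trmxK -!mulmxA (mulmxA P) PP mul1mx (mulmxA (T n)).
  by rewrite torus_mx_orth // mul1mx.
have gsx n : so_eigenvalues (gs n) (perturb x n).
  rewrite /so_eigenvalues (char_poly_orthogonal PP (Pgs n)) char_poly_torus_mx //.
  by congr (_ * _); apply: eq_bigr => i _; rewrite entry_ord.
have gs_cvg : gs n @[n --> \oo] --> g.
  have -> : g = P^T *m torus_mx m (entry x) *m P by rewrite -mulmxA -Pg mulmxA PP' mul1mx.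
  apply: cvg_entrywise => i j; apply: cvg_mulmx => {}i {}j; last exact: cvg_cst.
  apply: cvg_mulmx => {}i {}j; first exact: cvg_cst.
  by apply: cvg_torus_mx => k; exact: cvg_entry_perturb.
have rho_cvg : rho (gs n) @[n --> \oo] --> rho g.
  (* [rho] is continuous only relative to the group, so the approximants must stay inside it. *)
  move/subspace_continuousP: rho_cont => /(_ g gSO) rg.
  apply: (@cvg_comp _ _ _ gs rho _ _ _ _ rg) => U gU.
  have H : \forall n \near \oo, SO R _ (gs n) -> U (gs n) := gs_cvg _ gU.
  by change (\forall n \near \oo, U (gs n)); apply: filterS H => n; apply; exact: gsSO.
have chi_cvg : chi (gs n) @[n --> \oo] --> chi g.
  rewrite (chi_tr _ gSO); under eq_fun do rewrite chi_tr //.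
  apply: (@cvg_bigsum C) => i _; exact: (@cvg_entry C).
apply: (cvg_unique (@norm_hausdorff _ C) chi_cvg) => /=.
(* Second evaluation of the limit of [chi (gs n)]: for large [n] Weyl's formula applies to
   [gs n]. *)
have lim : char_poly_value l (perturb x n) @[n --> \oo] --> char_poly_value l x.
  by apply: cvg_char_poly_value tx _ => k; exact: cvg_entry_perturb.
apply: cvg_trans lim.
apply: near_eq_cvg; apply: filterS (perturb_regular tx) => n reg.
by rewrite (chi_weyl _ _ (gsSO n) (gsx n) reg) weyl_quotient.
Qed.
End CharacterValue.

(** * Geometrically dominated complex series *)

Section Series.
Variable R : realType.
Local Notation C := (cplx R).

Lemma cvg_geometric_bound (u : nat -> C) (B r : R) : 0 <= r -> r < 1 ->
  (forall n, `|u n| <= to_cplx (B * r ^+ n)) -> u n @[n --> \oo] --> (0 : C).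
Proof.
move=> r0 r1 uB; apply/cvgrPdist_lt => e /pos_cplx[d d0 ->].
have /cvgrPdist_lt/(_ d d0) : geometric B r n @[n --> \oo] --> 0.
  by apply: cvg_geometric; rewrite ger0_norm.
apply: filterS => n; rewrite !sub0r !normrN => h; apply: le_lt_trans (uB n) _.
by rewrite to_cplx_lt; apply: le_lt_trans h; exact: ler_norm.
Qed.

Lemma geometric_partial (a : nat -> C) (M r : R) K n : 0 <= r -> r < 1 ->
  (forall k, `|a k| <= to_cplx (M * r ^+ k)) ->
  `|\sum_(k < K + n) a k - \sum_(k < K) a k| <=
    to_cplx (M * (1 - r)^-1 * (r ^+ K - r ^+ (K + n))).
Proof.
move=> r0 r1 aM; have q0 : 1 - r != 0 by rewrite subr_eq0 gt_eqF.
elim: n => [|n IH]; first by rewrite addn0 !subrr normr0 mulr0 rmorph0.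
rewrite addnS big_ord_recr /= addrAC; apply: le_trans (ler_normD _ _) _.
have -> : M * (1 - r)^-1 * (r ^+ K - r ^+ (K + n).+1) =
  M * (1 - r)^-1 * (r ^+ K - r ^+ (K + n)) + M * r ^+ (K + n).
  by rewrite exprS; field.
by rewrite rmorphD; apply: lerD.
Qed.

Lemma cRe_sum (a : nat -> C) n : cRe (\sum_(k < n) a k) = \sum_(k < n) cRe (a k).
Proof. by rewrite /cRe raddf_sum. Qed.

Lemma cIm_sum (a : nat -> C) n : cIm (\sum_(k < n) a k) = \sum_(k < n) cIm (a k).
Proof. by rewrite /cIm raddf_sum. Qed.

Lemma cvg_real_series (u : nat -> R) (M r : R) : 0 <= r -> r < 1 ->
  (forall k, `|u k| <= M * r ^+ k) ->
  exists s : R, \sum_(k < n) u k @[n --> \oo] --> s.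
Proof.
move=> r0 r1 uM; suff /cvg_ex[s us] : cvgn (series u).
  by exists s; move: us; rewrite /series /=; under eq_fun do rewrite big_mkord.
apply: normed_cvg; apply: (@series_le_cvg _ _ (geometric M r)) => [n|n|n|] //=.
  by apply: le_trans (normr_ge0 _) (uM n).
by apply: is_cvg_geometric_series; rewrite ger0_norm.
Qed.

(** Convergence comes from the real and imaginary parts. The remainder depends on [M] and [r] alone,
    which makes it uniform over the torus. *)
Lemma geometric_limit (a : nat -> C) (M r : R) : 0 <= r -> r < 1 ->
  (forall k, `|a k| <= to_cplx (M * r ^+ k)) ->
  exists s : C, \sum_(k < n) a k @[n --> \oo] --> s /\
    forall K, `|s - \sum_(k < K) a k| <= to_cplx (M * (1 - r)^-1 * r ^+ K).
Proof.
move=> r0 r1 aM.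
have M0 : 0 <= M.
  by have := le_trans (normr_ge0 _) (aM 0%N); rewrite expr0 mulr1
    -(rmorph0 (@to_cplx R)) to_cplx_le.
have reM k : `|cRe (a k)| <= M * r ^+ k.
  apply: le_trans (cRe_le _) _.
  by have := aM k; rewrite lecE => /andP[_].
have imM k : `|cIm (a k)| <= M * r ^+ k.
  have -> : cIm (a k) = cRe (- cI R * a k) by rewrite /cRe /cIm /cI; case: (a k) => p q; simpc.
  apply: le_trans (cRe_le _) _; have := aM k; rewrite lecE => /andP[_].
  rewrite normrM normrN; have -> : `|cI R| = 1
    by apply/norm1_ReIm; rewrite /cRe /cIm /= expr0n add0r expr1n.
  by rewrite mul1r.
have [p re_p] := cvg_real_series r0 r1 reM; have [q im_q] := cvg_real_series r0 r1 imM.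
have cvg_s : \sum_(k < n) a k @[n --> \oo] --> to_cplx p + cI R * to_cplx q.
  rewrite (_ : (fun n => _) = fun n => to_cplx (\sum_(k < n) cRe (a k)) +
      cI R * to_cplx (\sum_(k < n) cIm (a k))); last first.
    by apply/funext => n; rewrite -cRe_sum -cIm_sum -cplxE.
  apply: (@cvgD C C^o); first exact: cvg_to_cplx.
  by apply: (@cvgM C); [exact: cvg_cst | exact: cvg_to_cplx].
exists (to_cplx p + cI R * to_cplx q); split=> // K; set s := _ + _ * _.
apply/ler_addgt0Pr => e e0.
have /cvgrPdist_lt/(_ e e0) [N _ hN] := cvg_s.
have := hN (K + N)%N (leq_addl _ _); rewrite -/s => h.
have -> : s - \sum_(k < K) a k =
  (\sum_(k < K + N) a k - \sum_(k < K) a k) + (s - \sum_(k < K + N) a k) by ring.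
apply: le_trans (ler_normD _ _) _; apply: lerD; last exact: ltW.
apply: le_trans (geometric_partial _ _ r0 r1 aM) _; rewrite to_cplx_le.
apply: ler_wpM2l; first by rewrite mulr_ge0 // invr_ge0 subr_ge0 ltW.
by rewrite gerBl exprn_ge0.
Qed.

(** Uniform limits preserve convergence, by the usual [e / 3] argument. *)
Lemma cvg_uniform_approx (T : Type) (F : set_system T) {FF : Filter F}
    (f : nat -> T -> C) (g : T -> C) (f0 : nat -> C) (g0 : C) (b : nat -> C) :
  (forall n, f n t @[t --> F] --> f0 n) ->
  (forall n, \forall t \near F, `|g t - f n t| <= b n) ->
  (forall n, `|g0 - f0 n| <= b n) -> b n @[n --> \oo] --> (0 : C) ->
  g t @[t --> F] --> g0.
Proof.
move=> ff gf g0f b0; apply/cvgrPdist_lt => e e0.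
have e3 : 0 < e / 3 by rewrite divr_gt0.
have /cvgrPdist_lt/(_ _ e3) [N _ /(_ N (leqnn N))] := b0.
rewrite sub0r normrN => bN.
have {}bN : b N < e / 3.
  by rewrite -(ger0_norm (le_trans (normr_ge0 _) (g0f N))).
have /cvgrPdist_lt/(_ _ e3) := ff N; apply: filterS2 (gf N) => t h1 h2.
have -> : g0 - g t = (g0 - f0 N) + (f0 N - f N t) + (f N t - g t) by ring.
have -> : e = e / 3 + e / 3 + e / 3 by field.
apply: le_lt_trans (ler_normD _ _) _; apply: ltrD.
  apply: le_lt_trans (ler_normD _ _) _; apply: ltrD => //.
  exact: le_lt_trans (g0f N) bN.
by rewrite distrC; exact: le_lt_trans h1 bN.
Qed.

End Series.

(** * Unconditional summation along an exhaustion *)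

Section UnconditionalSum.
Local Open Scope fset_scope.
Local Open Scope ring_scope.
Variables (R : realType) (I : choiceType).
Local Notation C := (cplx R).

Lemma big_fset_sub (V : nmodType) (A B : {fset I}) (f : I -> V) : A `<=` B ->
  \sum_(i <- B) f i = \sum_(i <- A) f i + \sum_(i <- B | i \notin A) f i.
Proof.
move=> /fsubsetP AB; rewrite (bigID (mem A)) /=; congr (_ + _).
rewrite -big_filter; apply: perm_big; apply: uniq_perm.
- by rewrite filter_uniq.
- by [].
by move=> i; rewrite mem_filter andb_idr // => /AB.
Qed.

Lemma partial_sumE (V : zmodType) (f : I -> V) (A : {fset I}) :
  partial_sum f A = \sum_(i <- A) f i.
Proof. by rewrite /partial_sum big_seq_fsetE. Qed.

(** Every finite set lies in some [A N], so the [g]-mass it has outside [A n] is at most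
    [limn b - b n], which tends to 0. Convergence along the [A n] thus extends to all finite
    sets. *)
Lemma totally_cvg_dominated (f : I -> C) (g : I -> R) (A : nat -> {fset I})
    (B : R) (S : C) :
  (forall i, `|f i| <= to_cplx (g i)) ->
  {homo A : n p / (n <= p)%N >-> n `<=` p} ->
  (forall i, exists n, i \in A n) ->
  (forall n, \sum_(i <- A n) g i <= B) ->
  \sum_(i <- A n) f i @[n --> \oo] --> S ->
  partial_sum f X @[X --> totally] --> S.
Proof.
move=> fg Amono Aexh AB fS.
have g0 i : 0 <= g i.
  by have := le_trans (normr_ge0 _) (fg i); rewrite -(rmorph0 (@to_cplx R)) to_cplx_le.
pose b n := \sum_(i <- A n) g i.
have b_nd : nondecreasing_seq b.
  by move=> n p np; rewrite /b (big_fset_sub _ (Amono _ _ np)) lerDl sumr_ge0.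
have b_cvg : cvgn b.
  by apply: nondecreasing_is_cvgn => //; exists B => _ [n _ <-]; exact: AB.
have A_exh (X : {fset I}) n : exists N, (n <= N)%N /\ X `<=` A N.
  suff [N XN] : exists N, X `<=` A N.
    exists (maxn n N); split; first exact: leq_maxl.
    by apply: fsubset_trans XN (Amono _ _ (leq_maxr _ _)).
  elim/finSet_rect: X => X IH.
  have [->|[i iX]] := fset_0Vmem X; first by exists 0%N; exact: fsub0set.
  have [N XN] := IH _ (fproperD1 iX); have [N' iN'] := Aexh i.
  exists (maxn N N'); apply/fsubsetP => j jX; have [->|ji] := eqVneq j i.
    by move/fsubsetP: (Amono _ _ (leq_maxr N N')); apply.
  move/fsubsetP: (Amono _ _ (leq_maxl N N')); apply; move/fsubsetP: XN; apply.
  by rewrite in_fsetD1 ji.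
have TF : ProperFilter (@totally I) := totally_filter.
apply/cvgrPdist_lt => e /pos_cplx[d d0 ->].
have d2 : 0 < d / 2 by rewrite divr_gt0.
have d2' : 0 < to_cplx (d / 2) by rewrite -(rmorph0 (@to_cplx R)) to_cplx_lt.
have [n [h1 h2]] : exists n, `|S - \sum_(i <- A n) f i| < to_cplx (d / 2) /\
    limn b - b n < d / 2.
  have /cvgrPdist_lt/(_ _ d2') E1 := fS.
  have /cvgrPdist_lt/(_ _ d2) E2 := b_cvg.
  have [n h] := @filter_ex _ \oo _ _ (filterI E1 E2).
  exists n; case: h => h1 h2; split=> //; exact: le_lt_trans (ler_norm _) h2.
exists (A n) => // X /= AX.
have [N [nN XN]] := A_exh X n.
rewrite partial_sumE (big_fset_sub _ AX) opprD addrA.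
have -> : to_cplx d = to_cplx (d / 2) + to_cplx (d / 2).
  by rewrite -rmorphD /=; congr to_cplx; field.
apply: le_lt_trans (ler_normB _ _) _; apply: ltrD => //.
apply: le_lt_trans (ler_norm_sum _ _ _) _.
apply: le_lt_trans (_ : to_cplx (\sum_(i <- X | i \notin A n) g i) < _).
  by rewrite rmorph_sum /=; apply: ler_sum => i _; exact: fg.
rewrite to_cplx_lt; apply: le_lt_trans h2.
apply: (@le_trans _ _ (\sum_(i <- A N | i \notin A n) g i)).
  rewrite big_mkcond [leRHS]big_mkcond /= (big_fset_sub _ XN) lerDl sumr_ge0 // => i _.
  by case: ifP.
rewrite lerBrDr addrC -(big_fset_sub g (Amono _ _ nN)).
exact: (nondecreasing_cvgn_le b_nd b_cvg).
Qed.

End UnconditionalSum.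

(** * Partitions as decreasing maps *)

Section PartitionsAndSubsets.
Variable m : nat.
Implicit Types l : mpartition m.

Lemma zero_partition_subproof : sorted geq (nseq_tuple m 0%N).
Proof. by rewrite /=; elim: m => [|[|n]]. Qed.

Definition zero_partition : mpartition m := 
  exist (fun l : m.-tuple nat => is_true (sorted geq l)) _ zero_partition_subproof.

Lemma label_decreasing l (i j : 'I_m) : (i < j)%N -> (label l j < label l i)%N.
Proof.
move=> ij; have lj := ltn_ord j; rewrite /label.
have : (part l j <= part l i)%N.
  rewrite /part !(tnth_nth 0%N).
  apply: (@sorted_ltn_nth _ geq _ 0%N (tval (val l)) (valP l)); rewrite ?inE ?size_tuple //.
  by move=> a b c /= ab ca; apply: leq_trans ca ab.
by lia.
Qed.

(** Source of the factor [z^C(m,2)]: the shifts [m - 1, ..., 0] add up to [C(m,2)]. *)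
Lemma sum_label l : (\sum_j label l j = weight l + 'C(m, 2))%N.
Proof.
rewrite /label big_split /=; congr (_ + _)%N.
rewrite -bin2_sum big_mkord (reindex_inj rev_ord_inj).
by apply: eq_bigr => j _ /=; have := ltn_ord j; lia.
Qed.

Lemma label_inj l l' : label l =1 label l' -> l = l'.
Proof.
move=> ll; apply/val_inj/eq_from_tnth => j.
by have := ll j; rewrite /label => /addIn.
Qed.

Variable K : nat.
Implicit Types k : {ffun 'I_m -> 'I_K}.

(** The [m - i.+1] later values are distinct and smaller than [k i]. *)
Lemma decreasing_lower k (i : 'I_m) : decreasing k -> (m - i.+1 <= k i)%N.
Proof.
move=> /decreasingP kd; have [n] := ubnP (m - i.+1); elim: n i => // n IH i.
have [im|im] := ltnP i.+1 m => mi; last first.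
  by have -> : (m - i.+1 = 0)%N by lia.
have := kd i (Ordinal im) (ltnSn _); have := IH (Ordinal im) => /=.
by lia.
Qed.

Lemma decreasing_gap k (i j : 'I_m) : decreasing k -> (i <= j)%N ->
  (k j + (j - i) <= k i)%N.
Proof.
move=> /decreasingP kd ij; have [n nE] : exists n, nat_of_ord j = (i + n)%N.
  by exists (j - i)%N; rewrite subnKC.
elim: n j nE ij => [|n IH] j nE ij.
  have -> : j = i by apply/val_inj; rewrite /= nE addn0.
  by rewrite subnn addn0.
have j'm : (i + n < m)%N by have := ltn_ord j; lia.
have j'j : (Ordinal j'm < j)%N by rewrite /= nE addnS.
by have := IH (Ordinal j'm) erefl (leq_addr _ _); have := kd _ _ j'j => /=; lia.
Qed.

(** Inverse of [label]; the default is reached only when the tuple is not sorted, never for a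
    decreasing [k]. *)
Definition to_part k : mpartition m :=
  insubd zero_partition [tuple (k j - (m - j.+1))%N | j < m].

Lemma label_to_part k : decreasing k -> forall j, label (to_part k) j = k j.
Proof.
move=> kd j; rewrite /label /part /to_part insubdK.
  by rewrite tnth_mktuple subnK // decreasing_lower.
rewrite -topredE /= /image_mem.
apply: (@homo_sorted _ _ _ (fun i j : 'I_m => (i < j)%N)).
  move=> a b ab; rewrite /geq /=; have := decreasing_gap kd (ltnW ab).
  by have := decreasing_lower a kd; have := decreasing_lower b kd; have := ltn_ord b; move: ab; lia.
by have := iota_ltn_sorted 0 m; rewrite -val_enum_ord sorted_map.
Qed.

Lemma to_part_inj : {in [pred k | decreasing k] &, injective to_part}.
Proof.
move=> k k'; rewrite !inE => kd kd' E; apply/ffunP => j; apply/val_inj.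
by rewrite /= -(label_to_part kd) E label_to_part.
Qed.

(** The exhaustion matched to truncating the kernel at [k < K]: Cauchy-Binet turns that truncation
    into exactly the sum over this set. *)
Definition box : {fset mpartition m} :=
  seq_fset tt [seq to_part k | k <- enum [pred k | decreasing k]].

Lemma box_uniq : uniq [seq to_part k | k <- enum [pred k | decreasing k]].
Proof.
by rewrite map_inj_in_uniq ?enum_uniq // => k k'; rewrite !mem_enum; exact: to_part_inj.
Qed.

Lemma in_box l : (l \in box) = [forall j, label l j < K]%N.
Proof.
rewrite /box seq_fsetE; apply/mapP/forallP => [[k]|lK].
  by rewrite mem_enum inE => kd -> j; rewrite label_to_part.
pose k := [ffun j => Ordinal (lK j)].
have kd : decreasing k.
  by apply/decreasingP => i j ij; rewrite !ffunE; exact: label_decreasing.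
exists k; first by rewrite mem_enum.
by apply: label_inj => j; rewrite label_to_part // ffunE.
Qed.

Lemma big_box (V : nmodType) (f : mpartition m -> V) :
  \sum_(l <- box) f l = \sum_(k | decreasing k) f (to_part k).
Proof.
rewrite (perm_big [seq to_part k | k <- enum [pred k | decreasing k]]) /=.
  by rewrite big_map big_enum.
exact: (uniq_perm (fset_uniq box) box_uniq (seq_fsetE _ _)).
Qed.

End PartitionsAndSubsets.

Lemma box_mono m : {homo box m : n p / (n <= p)%N >-> (n `<=` p)%fset}.
Proof.
move=> n p np; apply/fsubsetP => l; rewrite !in_box => /forallP h.
by apply/forallP => j; apply: leq_trans (h j) np.
Qed.

Lemma box_exhausts m (l : mpartition m) : exists n, l \in box m n.
Proof.
exists (\max_j label l j).+1; rewrite in_box; apply/forallP => j.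
by rewrite ltnS (leq_bigmax j).
Qed.

(** * The kernel matrix G, its truncations and the domination of the sum *)

Section CauchyKernel.
Variables (R : realType) (m : nat) (z : R).
Hypotheses (z0 : 0 < z) (z1 : z < 1).
Local Notation C := (cplx R).
Local Notation zc := (to_cplx z : C).
Implicit Types (x y : 'rV[C]_m).

Lemma exists_growth : exists rho : R, 1 < rho /\ z * rho ^+ 2 < 1.
Proof.
(* Chosen so that [z * q] is the midpoint of [z] and 1; then [rho] is the square root of [q]. *)
pose q := (1 + z) / (2 * z); have zz : z != 0 by rewrite gt_eqF.
have q1 : 1 < q by rewrite /q ltr_pdivlMr ?mulr_gt0 // mul1r mulr_natl mulr2n ltrD2r.
have q0 : 0 <= q by apply/ltW/(lt_trans _ q1).
exists (Num.sqrt q); split.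
  by rewrite -[ltLHS]sqrtr1 ltr_sqrt // (lt_trans _ q1).
have -> : z * Num.sqrt q ^+ 2 = (1 + z) / 2 by rewrite sqr_sqrtr // /q; field.
by rewrite ltr_pdivrMr // mul1r (_ : 2 = 1 + 1) // ltrD2l.
Qed.

Lemma ddiff_bound_real (rho : R) : 1 < rho ->
  exists M : R, 0 <= M /\ forall (i : 'I_m) (xs : nat -> C), (forall l, `|xs l| = 1) ->
    forall k, `|ddiff xs i k| <= to_cplx (M * rho ^+ k).
Proof.
move=> rho1; have rho1' : 1 < to_cplx rho by rewrite -(rmorph1 (@to_cplx R)) to_cplx_lt.
have Mi (i : 'I_m) : exists M : R, 0 <= M /\ forall xs : nat -> C, (forall l, `|xs l| = 1) ->
    forall k, `|ddiff xs i k| <= to_cplx (M * rho ^+ k).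
  have [M MP] := ddiff_bound i rho1'.
  have M0 : 0 <= M.
    (* Testing the bound on constant nodes 1 shows [0 <= M] in the complex numbers, so [M] is
       real. *)
    have := MP (fun=> 1) (fun=> normr1 _) 0%N; rewrite expr0 mulr1.
    exact: le_trans.
  have ME : M = to_cplx (cRe M).
    by rewrite [LHS]cplxE (_ : cIm M = 0) ?rmorph0 ?mulr0 ?addr0 //; exact: ger0_Im.
  exists (cRe M); split; first by rewrite -to_cplx_le -ME rmorph0.
  by move=> xs xs1 k; rewrite rmorphM rmorphXn /= -ME; exact: MP.
have [M MP] := choice Mi.
exists (\sum_i M i); split; first by apply: sumr_ge0 => i _; have [] := MP i.
move=> i xs xs1 k; have [_ /(_ xs xs1 k) h] := MP i; apply: le_trans h _.
rewrite to_cplx_le ler_wpM2r ?exprn_ge0 //; first by apply/ltW/(lt_trans _ rho1).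
rewrite (bigD1 i) //= lerDl sumr_ge0 // => j _; by have [] := MP j.
Qed.

Definition kernel_term x y (i j : 'I_m) (k : nat) : C :=
  zc ^+ k * ddiff (entry x) i k * ddiff (entry y) j k.

Definition kernel_partial n x y : 'M[C]_m :=
  \matrix_(i, j) \sum_(k < n) kernel_term x y i j k.

Definition kernel_mx x y : 'M[C]_m :=
  \matrix_(i, j) limn (fun n => \sum_(k < n) kernel_term x y i j k).

Lemma kernel_approx : exists B r : R, [/\ 0 <= r, r < 1 &
  forall x y, torus R m x -> torus R m y -> forall i j,
    kernel_partial n x y i j @[n --> \oo] --> kernel_mx x y i j /\
    forall n, `|kernel_mx x y i j - kernel_partial n x y i j| <= to_cplx (B * r ^+ n)].
Proof.
have [rho [rho1 zrho]] := exists_growth; have [M [M0 MP]] := ddiff_bound_real rho1.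
pose r := z * rho ^+ 2; have r0 : 0 <= r by rewrite mulr_ge0 ?sqr_ge0 // ltW.
exists (M ^+ 2 * (1 - r)^-1), r; split=> // x y tx ty i j.
have bnd k : `|kernel_term x y i j k| <= to_cplx (M ^+ 2 * r ^+ k).
  rewrite /kernel_term !normrM normrX norm_to_cplx (gtr0_norm z0).
  have -> : M ^+ 2 * r ^+ k = z ^+ k * (M * rho ^+ k) * (M * rho ^+ k).
    by rewrite /r exprMn -exprM mulnC exprM; ring.
  have zk : 0 <= zc ^+ k.
    by rewrite exprn_ge0 // -(rmorph0 (@to_cplx R)) to_cplx_le ltW.
  rewrite [leRHS]rmorphM; apply: ler_pM => //; first exact: mulr_ge0 zk (normr_ge0 _).
    rewrite [leRHS]rmorphM [X in _ <= X * _]rmorphXn; apply: (ler_wpM2l zk).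
    by apply: MP; exact: entry_norm1.
  by apply: MP; exact: entry_norm1.
have [s [sl sb]] := geometric_limit r0 zrho bnd.
have -> : kernel_mx x y i j = s by rewrite mxE; apply: cvg_lim => //; exact: norm_hausdorff.
by split=> [|n]; [under eq_fun do rewrite mxE | rewrite mxE; exact: sb].
Qed.

(** Cauchy-Binet with the powers of [z] placed in the left factor. Both characters carry the same
    reversal sign, whose square is 1. *)
Lemma det_kernel_partial n x y :
  \det (kernel_partial n x y) = zc ^+ 'C(m, 2) *
    \sum_(l <- box m n) zc ^+ weight l * char_poly_value l x * char_poly_value l y.
Proof.
pose A : 'M[C]_(m, n) := \matrix_(i, k) (zc ^+ k * ddiff (entry x) i k).
pose B : 'M[C]_(n, m) := \matrix_(k, j) ddiff (entry y) j k.
have -> : kernel_partial n x y = A *m B.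
  by apply/matrixP => i j; rewrite !mxE; apply: eq_bigr => k _; rewrite !mxE.
rewrite cauchy_binet big_box big_distrr /=; apply: eq_bigr => k kd.
have -> : colsub k A = ddiff_mx m (entry x) (label (to_part k)) *m
    diag_mx (\row_j zc ^+ k j).
  by rewrite mul_mx_diag; apply/matrixP => i j; rewrite !mxE label_to_part // mulrC.
have -> : rowsub k B = (ddiff_mx m (entry y) (label (to_part k)))^T.
  by apply/matrixP => i j; rewrite !mxE label_to_part.
rewrite det_tr det_mulmx det_diag /char_poly_value.
have -> : \prod_i (\row_j zc ^+ k j) 0 i = zc ^+ 'C(m, 2) * zc ^+ weight (to_part k).
  rewrite -exprD addnC -sum_label -prodrXr; apply: eq_bigr => i _.
  by rewrite mxE label_to_part.
set s := (-1) ^+ _; have s2 : s * s = 1 by rewrite -expr2 sqrr_sign.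
set a := \det _; set b := \det _; set w := _ ^+ weight _; set c := _ ^+ _.
transitivity (c * w * a * b * (s * s)); last by ring.
by rewrite s2; ring.
Qed.

Lemma zc_neq0 : zc != 0.
Proof. by rewrite fmorph_eq0 gt_eqF. Qed.

(** Each determinant is expanded over permutations, every term being at most [M^m] times the powers
    of [rho]. The product form of the bound makes it summable coordinate by coordinate. *)
Lemma char_poly_value_bound : exists c r : R, [/\ 0 <= c, 0 <= r, r < 1 &
  forall x y, torus R m x -> torus R m y -> forall l,
   `|zc ^+ weight l * char_poly_value l x * char_poly_value l y| <=
     to_cplx (c * \prod_j r ^+ label l j)].
Proof.
have [rho [rho1 zrho]] := exists_growth; have [M [M0 MP]] := ddiff_bound_real rho1.
have rho0 : 0 <= rho by apply/ltW/(lt_trans _ rho1).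
pose r := z * rho ^+ 2; have r0 : 0 <= r by rewrite mulr_ge0 ?sqr_ge0 // ltW.
pose b := \sum_(s : 'S_m) M ^+ m.
have b0 : 0 <= b by apply: sumr_ge0 => s _; exact: exprn_ge0.
have bnd x l : torus R m x ->
    `|char_poly_value l x| <= to_cplx (b * \prod_j rho ^+ label l j).
  move=> tx; rewrite normrM normrX normrN normr1 expr1n mul1r.
  apply: le_trans (ler_norm_sum _ _ _) _; rewrite /b mulr_suml rmorph_sum /=.
  apply: ler_sum => s _; rewrite normrM normrX normrN normr1 expr1n mul1r.
  have -> : M ^+ m * \prod_j rho ^+ label l j = \prod_i (M * rho ^+ label l (s i)).
    by rewrite big_split /= prodr_const card_ord [in LHS](reindex_inj (@perm_inj _ s)).
  rewrite normr_prod rmorph_prod /=; apply: ler_prod => i _.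
  by rewrite normr_ge0 mxE; apply: MP; exact: entry_norm1.
(* The negative power of [z] compensates for replacing the weight by the larger sum of the
   labels. *)
exists (b ^+ 2 * z ^- 'C(m, 2)), r; split=> //.
  by rewrite mulr_ge0 ?exprn_ge0 // invr_ge0 exprn_ge0 // ltW.
move=> x y tx ty l; rewrite normrM (normrM (zc ^+ weight l)) normrX norm_to_cplx (gtr0_norm z0).
pose p := \prod_j rho ^+ label l j.
have p0 : 0 <= p by apply: prodr_ge0 => j _; exact: exprn_ge0.
have -> : b ^+ 2 * z ^- 'C(m, 2) * \prod_j r ^+ label l j =
    z ^+ weight l * (b * p) * (b * p).
  have -> : \prod_j r ^+ label l j = z ^+ 'C(m, 2) * z ^+ weight l * p ^+ 2.
    rewrite -exprD addnC -sum_label -prodrXr /p -prodrXl -big_split /=.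
    by apply: eq_bigr => j _; rewrite exprMn -!exprM mulnC.
  by field; rewrite expf_neq0 // gt_eqF.
have zw : 0 <= to_cplx z ^+ weight l.
  by rewrite exprn_ge0 // -(rmorph0 (@to_cplx R)) to_cplx_le ltW.
rewrite [leRHS]rmorphM; apply: ler_pM => //; first exact: mulr_ge0 zw (normr_ge0 _).
  by rewrite [leRHS]rmorphM [X in _ <= X * _]rmorphXn; apply: (ler_wpM2l zw); exact: bnd.
exact: bnd.
Qed.

End CauchyKernel.

(** * The determinant identity and its limit at singular points *)

Section CauchyIdentity.
Variables (R : realType) (m : nat) (z : R).
Hypotheses (z0 : 0 < z) (z1 : z < 1).
Local Notation C := (cplx R).
Local Notation zc := (to_cplx z : C).
Implicit Types (x y : 'rV[C]_m).

Lemma geometric_sum_le (r : R) n : 0 <= r -> r < 1 -> \sum_(i < n) r ^+ i <= (1 - r)^-1.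
Proof.
move=> r0 r1; have q0 : 0 < 1 - r by rewrite subr_gt0.
rewrite -[leRHS]mul1r ler_pdivlMr // mulrC -opprB mulNr -subrX1 opprB.
by rewrite gerBl exprn_ge0.
Qed.

(** Enlarging the sum to all maps makes it a product of [m] geometric sums. *)
Lemma box_sum_le (c r : R) n : 0 <= c -> 0 <= r -> r < 1 ->
  \sum_(l <- box m n) c * \prod_j r ^+ label l j <= c * ((1 - r)^-1) ^+ m.
Proof.
move=> c0 r0 r1; rewrite big_box -big_distrr /=; apply: ler_wpM2l => //.
apply: (@le_trans _ _ (\sum_(k : {ffun 'I_m -> 'I_n}) \prod_j r ^+ k j)).
  rewrite big_mkcond; apply: ler_sum => k _; case: ifP => kd.
    by apply: ler_prod => j _; rewrite exprn_ge0 //= label_to_part.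
  by apply: prodr_ge0 => j _; exact: exprn_ge0.
rewrite -(bigA_distr_bigA (fun (i : 'I_m) (j : 'I_n) => r ^+ j)) prodr_const card_ord.
apply: lerXn2r; rewrite ?nnegrE ?invr_ge0 ?subr_ge0 ?(ltW r1) ?geometric_sum_le //.
by apply: sumr_ge0 => i _; exact: exprn_ge0.
Qed.

Lemma character_sum x y : torus R m x -> torus R m y ->
  partial_sum (fun l => zc ^+ weight l * char_poly_value l x * char_poly_value l y) A
    @[A --> totally] --> (zc ^+ 'C(m, 2))^-1 * \det (kernel_mx z x y).
Proof.
move=> tx ty; have [c [r [c0 r0 r1 bnd]]] := char_poly_value_bound m z0 z1.
have [B [s [s0 s1 kx]]] := kernel_approx m z0 z1.
apply: (totally_cvg_dominated (g := fun l => c * \prod_j r ^+ label l j) (bnd _ _ tx ty)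
  (@box_mono m) (@box_exhausts m) (B := c * ((1 - r)^-1) ^+ m)).
  by move=> n; exact: box_sum_le.
have -> : (fun n => \sum_(l <- box m n) zc ^+ weight l * char_poly_value l x * char_poly_value l y)
  = fun n => (zc ^+ 'C(m, 2))^-1 * \det (kernel_partial z n x y).
  by apply/funext => n; rewrite det_kernel_partial mulKf // expf_neq0 // zc_neq0.
apply: (@cvgM C); first exact: (@cvg_cst C).
by apply: (@cvg_det C) => i j; have [] := kx x y tx ty i j.
Qed.

(** The truncations converge along [F] and approximate the kernel uniformly on the torus; the limit
    point may have colliding eigenvalues. *)
Lemma cvg_det_kernel (T : Type) (F : set_system T) {FF : Filter F}
    (xs ys : T -> 'rV[C]_m) x y :
  torus R m x -> torus R m y ->
  (\forall t \near F, torus R m (xs t) /\ torus R m (ys t)) ->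
  (forall l, entry (xs t) l @[t --> F] --> entry x l) ->
  (forall l, entry (ys t) l @[t --> F] --> entry y l) ->
  \det (kernel_mx z (xs t) (ys t)) @[t --> F] --> \det (kernel_mx z x y).
Proof.
move=> tx ty txy xx yy; have [B [r [r0 r1 kx]]] := kernel_approx m z0 z1.
apply: (@cvg_det C) => i j.
apply: (@cvg_uniform_approx R T F FF (fun n t => kernel_partial z n (xs t) (ys t) i j)
  _ (fun n => kernel_partial z n x y i j) _ (fun n => to_cplx (B * r ^+ n))).
- move=> n; rewrite mxE; under eq_fun do rewrite mxE.
  apply: (@cvg_bigsum C) => k _; apply: (@cvgM C).
    apply: (@cvgM C); first exact: (@cvg_cst C).
    exact: (@cvg_ddiff C T F FF (fun t => entry (xs t)) _ (entry_neq0 tx) xx i k).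
  exact: (@cvg_ddiff C T F FF (fun t => entry (ys t)) _ (entry_neq0 ty) yy j k).
- by move=> n; apply: filterS txy => t [txt tyt]; have [_ ->] := kx _ _ txt tyt i j.
- by move=> n; have [_ ->] := kx _ _ tx ty i j.
apply: (@cvg_geometric_bound R _ `|B| r) => // n.
by rewrite norm_to_cplx normrM normrX (ger0_norm r0).
Qed.

(** The sign [(-1)^C(m,2)] between [u_i - u_j] for [i < j] in [vdm] and for [j < i] in the Newton
    determinant; it occurs once for [x] and once for [y]. *)
Definition vdm_sign : C := \prod_(i < m) \prod_(j < m | (j < i)%N) (-1).

Lemma vdm_sign_sqr : vdm_sign * vdm_sign = 1.
Proof.
rewrite /vdm_sign -big_split big1 //= => i _; rewrite -big_split big1 //= => j _.
by rewrite mulrNN mulr1.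
Qed.

Lemma vdm_newton x : vdm x = vdm_sign * \det (newton_mx m (entry x)).
Proof.
rewrite det_newton_mx /vdm (exchange_big_dep xpredT) //= /vdm_sign -big_split /=.
apply: eq_bigr => i _.
rewrite (big_ord_widen_cond m xpredT (fun p => recip_sum (entry x i) - recip_sum (entry x p))
  (ltnW (ltn_ord i))) /= -big_split /=.
by apply: eq_bigr => j _; rewrite mulN1r opprB !entry_ord.
Qed.

Lemma norm_zc_lt1 (c : C) : `|c| = 1 -> 1 - zc * c != 0.
Proof.
move=> c1; rewrite subr_eq0; apply: contraTneq z1 => E.
have : `|zc * c| = 1 by rewrite -E normr1.
rewrite normrM c1 mulr1 norm_to_cplx gtr0_norm // -(rmorph1 (@to_cplx R)) => /complexI ->.
by rewrite ltxx.
Qed.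

Lemma cauchy_den_neq0 (a b : C) : `|a| = 1 -> `|b| = 1 -> cauchy_den zc a b != 0.
Proof.
move=> a1 b1; rewrite /cauchy_den -!(mulrA zc) !mulf_neq0 //; apply: norm_zc_lt1;
  by rewrite normrM ?normfV a1 b1 ?invr1 mulr1.
Qed.

Lemma kernel_partial_newton n x y : torus R m x -> torus R m y ->
  newton_mx m (entry x) *m kernel_partial z n x y *m (newton_mx m (entry y))^T =
  \matrix_(i, j) \sum_(k < n) zc ^+ k * odd_char (x 0 i) k * odd_char (y 0 j) k.
Proof.
move=> tx ty; pose d : 'rV[C]_n := \row_k zc ^+ k.
have -> : kernel_partial z n x y = ddiff_mx m (entry x) (fun k : 'I_n => k : nat) *m
    diag_mx d *m (ddiff_mx m (entry y) (fun k : 'I_n => k : nat))^T.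
  apply/matrixP => i j; rewrite mul_mx_diag !mxE; apply: eq_bigr => k _.
  by rewrite !mxE /kernel_term [zc ^+ k * _]mulrC.
rewrite !mulmxA -odd_char_mxE; last exact: entry_neq0.
rewrite -mulmxA -trmx_mul -odd_char_mxE; last exact: entry_neq0.
rewrite mul_mx_diag; apply/matrixP => i j; rewrite !mxE; apply: eq_bigr => k _.
by rewrite !mxE !entry_ord [zc ^+ k * _]mulrC.
Qed.

Lemma cvg_odd_char_product (a b : C) p q : `|a| = 1 -> `|b| = 1 -> (0 < m)%N ->
  zc ^+ n * (odd_char a (n + p) * odd_char b (n + q)) @[n --> \oo] --> (0 : C).
Proof.
move=> a1 b1 m0; have [rho [rho1 zrho]] := exists_growth z0 z1.
have [M [M0 MP]] := @ddiff_bound_real R m rho rho1.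
pose r := z * rho ^+ 2; have r0 : 0 <= r by rewrite mulr_ge0 ?sqr_ge0 // ltW.
have oddb c k : `|c| = 1 -> `|odd_char c k| <= to_cplx (M * rho ^+ k).
  (* [odd_char c] is the divided difference of order 0 at constant nodes [c]. *)
  by move=> c1; have := MP (Ordinal m0) (fun=> c) (fun=> c1) k.
apply: (@cvg_geometric_bound R _ (M ^+ 2 * rho ^+ p * rho ^+ q) r) => // n.
rewrite normrM (normrM (odd_char _ _)) normrX norm_to_cplx (gtr0_norm z0).
have -> : M ^+ 2 * rho ^+ p * rho ^+ q * r ^+ n =
    z ^+ n * ((M * rho ^+ (n + p)) * (M * rho ^+ (n + q))).
  by rewrite /r !exprD exprMn -exprM mulnC exprM; ring.
have zn : 0 <= zc ^+ n by rewrite exprn_ge0 // -(rmorph0 (@to_cplx R)) to_cplx_le ltW.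
rewrite [leRHS]rmorphM [X in _ <= X * _]rmorphXn; apply: (ler_wpM2l zn).
by rewrite [leRHS]rmorphM; apply: ler_pM => //; exact: oddb.
Qed.

(** In the telescoped partial sum the boundary term is a combination of four products of size
    [(z rho^2)^n], so it disappears in the limit. *)
Lemma cvg_cauchy_kernel (a b : C) : `|a| = 1 -> `|b| = 1 -> (0 < m)%N ->
  \sum_(k < n) zc ^+ k * odd_char a k * odd_char b k @[n --> \oo] -->
  (1 - zc) * ((1 + zc) ^+ 2 + zc * (a + a^-1 + b + b^-1)) / cauchy_den zc a b.
Proof.
move=> a1 b1 m0; have D0 := cauchy_den_neq0 a1 b1.
set N := (1 - zc) * _.
pose u := recip_sum a; pose v := recip_sum b.
have tele0 : zc ^+ n * tele_coef zc u v (odd_char a n) (odd_char a n.+1)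
    (odd_char b n) (odd_char b n.+1) @[n --> \oo] --> (0 : C).
  pose t p q n := zc ^+ n * (odd_char a (n + p) * odd_char b (n + q)).
  rewrite (_ : (fun n => _) = fun n =>
    (1 - zc ^+ 2 - zc ^+ 3 * u * v + zc ^+ 2 * (u ^+ 2 + v ^+ 2) - zc * u * v) * t 0%N 0%N n
    + zc ^+ 2 * (zc * u - v) * t 0%N 1%N n + zc ^+ 2 * (zc * v - u) * t 1%N 0%N n
    + zc * (1 - zc ^+ 2) * t 1%N 1%N n); last first.
    by apply/funext => n; rewrite /t /tele_coef !addn0 !addn1; ring.
  have t0 c p q : c * t p q n @[n --> \oo] --> (0 : C).
    suff : c * t p q n @[n --> \oo] --> c * (0 : C) by rewrite mulr0.
    by apply: (@cvgM C); [exact: (@cvg_cst C) | exact: cvg_odd_char_product].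
  rewrite -[X in _ --> X](_ : 0 + 0 + 0 + 0 = 0 :> C); last by rewrite !addr0.
  apply: (@cvgD C C^o) (t0 _ _ _); apply: (@cvgD C C^o) (t0 _ _ _).
  exact: (@cvgD C C^o) (t0 _ _ _) (t0 _ _ _).
rewrite (_ : (fun n => _) = fun n => (N - zc ^+ n * tele_coef zc u v (odd_char a n)
    (odd_char a n.+1) (odd_char b n) (odd_char b n.+1)) / cauchy_den zc a b); last first.
  apply/funext => n; rewrite -cauchy_kernel_partial ?norm1_neq0 //.
  by rewrite mulrC mulKf.
apply: (@cvgM C); last exact: (@cvg_cst C).
suff : N - zc ^+ n * tele_coef zc u v (odd_char a n) (odd_char a n.+1)
    (odd_char b n) (odd_char b n.+1) @[n --> \oo] --> N - 0 by rewrite subr0.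
by apply: (@cvgD C C^o); [exact: (@cvg_cst C) | exact: (@cvgN C C^o)].
Qed.

(** Both sides are entrywise limits of the same truncated product. *)
Lemma newton_kernel x y : torus R m x -> torus R m y ->
  newton_mx m (entry x) *m kernel_mx z x y *m (newton_mx m (entry y))^T =
  (1 - zc) *: cauchy_mx zc x y.
Proof.
move=> tx ty; apply/matrixP => i j.
have [B [r [r0 r1 kx]]] := kernel_approx m z0 z1.
have m0 : (0 < m)%N by apply: leq_ltn_trans (ltn_ord i).
have l1 : (newton_mx m (entry x) *m kernel_partial z n x y *m (newton_mx m (entry y))^T) i j
    @[n --> \oo] -->
    (newton_mx m (entry x) *m kernel_mx z x y *m (newton_mx m (entry y))^T) i j.
  apply: (@cvg_mulmx C) => [{}i {}j|{}i {}j]; last exact: (@cvg_cst C).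
  apply: (@cvg_mulmx C) => {}i {}j; first exact: (@cvg_cst C).
  by have [] := kx x y tx ty i j.
apply: (cvg_unique (@norm_hausdorff _ C) l1) => /=.
under eq_fun do rewrite kernel_partial_newton // mxE.
rewrite !mxE mulrA; exact: cvg_cauchy_kernel.
Qed.

(** Determinants of [newton_kernel]; scaling [m] rows yields [(1 - z)^m]. Kept free of division, it
    holds at singular points too. *)
Lemma vdm_kernel x y : torus R m x -> torus R m y ->
  vdm y * vdm x * \det (kernel_mx z x y) = (1 - zc) ^+ m * \det (cauchy_mx zc x y).
Proof.
move=> tx ty; rewrite -detZ -newton_kernel // !det_mulmx det_tr !vdm_newton.
set s := vdm_sign; set a := \det (newton_mx _ _); set b := \det (newton_mx _ _).
transitivity ((s * s) * (b * \det (kernel_mx z x y) * a)); first by ring.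
by rewrite vdm_sign_sqr mul1r.
Qed.

Lemma cvg_entry_row (T : Type) (F : set_system T) {FF : Filter F}
    (xs : T -> 'rV[C]_m) x : xs t @[t --> F] --> x ->
  forall l, entry (xs t) l @[t --> F] --> entry x l.
Proof.
move=> xx l; rewrite /entry; case: insub => [i|] /=; last exact: (@cvg_cst C).
exact: (@cvg_entry C).
Qed.

End CauchyIdentity.

Theorem theorem3p1 (R : realType) (m : nat) (hm : (0 < m)%N)
    (so : mpartition m -> 'M[R]_(m.*2.+1) -> cplx R)
    (hso : forall l : mpartition m, so_character l (so l))
    (g h : 'M[R]_(m.*2.+1)) (hg : SO R m.*2.+1 g) (hh : SO R m.*2.+1 h)
    (x y : 'rV[cplx R]_m) (hx : so_eigenvalues g x) (hy : so_eigenvalues h y)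
    (z : R) (hz0 : 0 < z) (hz1 : z < 1) :
  let zc : cplx R := to_cplx z in
  let term : mpartition m -> cplx R :=
    fun l => zc ^+ weight l * so l g * so l h in
  exists S : cplx R,
    (partial_sum term A @[A --> totally] --> S) /\
    quotient_value (torus R m `*` torus R m)
      (fun p : 'rV[cplx R]_m * 'rV[cplx R]_m =>
         (1 - zc) ^+ m * \det (cauchy_mx zc p.1 p.2))
      (fun p : 'rV[cplx R]_m * 'rV[cplx R]_m =>
         zc ^+ 'C(m, 2) * vdm p.2 * vdm p.1)
      (x, y) S.
Proof.
move=> zc term; have tx := so_eigenvalues_torus hg hx; have ty := so_eigenvalues_torus hh hy.
have zc0 : zc ^+ 'C(m, 2) != 0 by rewrite expf_neq0 // zc_neq0.
have quot (p : 'rV[cplx R]_m * 'rV[cplx R]_m) : torus R m p.1 -> torus R m p.2 ->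
    zc ^+ 'C(m, 2) * vdm p.2 * vdm p.1 != 0 ->
    (zc ^+ 'C(m, 2))^-1 * \det (kernel_mx z p.1 p.2) =
    (1 - zc) ^+ m * \det (cauchy_mx zc p.1 p.2) / (zc ^+ 'C(m, 2) * vdm p.2 * vdm p.1).
  move=> t1 t2 D0; rewrite -vdm_kernel //; move: D0; rewrite -mulrA mulf_eq0 negb_or => /andP[_ v0].
  move: v0; set v := vdm _ * vdm _ => v0; set K := \det _; set c := zc ^+ _.
  by field; rewrite v0 zc0.
(* This value makes sense at every torus point and serves both cases of [quotient_value]. *)
exists ((zc ^+ 'C(m, 2))^-1 * \det (kernel_mx z x y)); split.
  rewrite (_ : term = fun l => zc ^+ weight l * char_poly_value l x * char_poly_value l y).
    exact: character_sum.
  apply/funext => l; rewrite /term.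
  by rewrite (so_character_value (hso l) hg hx) (so_character_value (hso l) hh hy).
rewrite /quotient_value; case: ifPn => [D0|_]; first exact: (quot (x, y)).
(* Singular case: on [A] the quotient equals the kernel determinant up to the power of [z], and the
   latter converges along [F]. *)
set A := _ `&` _; set F := within _ _.
have FA : F A by exact: withinT.
have Fp : F --> (x, y) by exact: cvg_within.
have lim : (zc ^+ 'C(m, 2))^-1 * \det (kernel_mx z q.1 q.2) @[q --> F] -->
    (zc ^+ 'C(m, 2))^-1 * \det (kernel_mx z x y).
  apply: (@cvgM (cplx R)); first exact: (@cvg_cst (cplx R)).
  apply: (@cvg_det_kernel R m z hz0 hz1 _ F _ fst snd) => //.
  - by apply: filterS FA => q [].
  - by apply: cvg_entry_row; apply: (cvg_comp _ _ Fp); exact: cvg_fst.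
  - by apply: cvg_entry_row; apply: (cvg_comp _ _ Fp); exact: cvg_snd.
apply: cvg_trans lim; apply: near_eq_cvg; apply: filterS FA => q [[t1 t2] D0].
by rewrite quot.
Qed.
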